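(* Fix $t\in\mathbb{R}$ and let $\alpha_{i,n}$ be the local levels of the one-sided HC test with critical values $h_{i,n}(d_n(t))$. Let $i_n\in\{1,\dots,n\}$ be a sequence of ranks such that, as $n\to\infty$, one of the following holds: (a) $i_n/u_n\to\infty$ and $i_n/u_n^3\to0$, or $i_n/u_n^3\to c$ for some $c>0$; in this case set $\zeta_n=\sqrt{u_n/i_n}$; (b) $(n-i_n)/u_n\to\infty$ and $(n-i_n)/u_n^3\to0$, or $(n-i_n)/u_n^3\to c$ for some $c>0$; in this case set $\zeta_n=-\sqrt{u_n/(n-i_n)}$. Then $$\alpha_{i_n,n}=\frac{\exp(-t)}{2u_n\log(n)}\exp\Bigl(\frac{\sqrt2\,\zeta_n}{3}\bigl(u_n+o(u_n)\bigr)\Bigr).$$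
   Context: Let $u_n=\log(\log(n))$ and, for fixed $t\in\mathbb{R}$, $d_n(t)=\bigl(t+2u_n+(\log(u_n)-\log(\pi))/2\bigr)/\sqrt{2u_n}$ (everything is considered for $n$ large enough to be defined with $d_n(t)\ge1$). For $1\le i\le n$ let $$h_{i,n}(d)=\frac{d^2+2i-d\sqrt{d^2+4i-4i^2/n}}{2(d^2+n)}.$$ The local levels of the one-sided higher criticism (HC) test based on $d_n(t)$ are $\alpha_{i,n}=\mathbb{P}(U_{i:n}<h_{i,n}(d_n(t)))=\mathbb{P}(Z_n\ge i)$, where $U_{i:n}$ is the $i$th order statistic of $n$ i.i.d. uniform random variables on $[0,1]$ and $Z_n$ is binomial with parameters $n$ and $h_{i,n}(d_n(t))$. Asymptotic symbols refer to $n\to\infty$. *)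

(* Defs.v *)
From HB Require Import structures.
From mathcomp Require Import all_boot all_order all_algebra.
From mathcomp Require Import all_classical all_reals all_analysis.

Set Implicit Arguments.
Unset Strict Implicit.
Unset Printing Implicit Defensive.

Import Order.TTheory GRing.Theory Num.Theory.
Import numFieldNormedType.Exports.

Local Open Scope classical_set_scope.
Local Open Scope ring_scope.

(* [ln] and [Num.sqrt] are total (0 outside their natural domain), so [loglog]
   and [hc_level] are defined for every [n] but carry their intended meaning
   only for large [n]. *)
Definition loglog (R : realType) (n : nat) : R := ln (ln n%:R).

Definition hc_level (R : realType) (t : R) (n : nat) : R :=
  (t + 2 * loglog R n + (ln (loglog R n) - ln pi) / 2)
  / Num.sqrt (2 * loglog R n).

Definition hc_crit (R : realType) (n i : nat) (d : R) : R :=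
  (d ^+ 2 + 2 * i%:R
   - d * Num.sqrt (d ^+ 2 + 4 * i%:R - 4 * i%:R ^+ 2 / n%:R))
  / (2 * (d ^+ 2 + n%:R)).

(* Ranks start at 1: the [i]-th order statistic of [x], for [1 <= i <= n]. *)
Definition order_stat (R : realType) (n : nat) (x : 'I_n -> R) (i : nat) : R :=
  nth 0 (sort <=%R (codom x)) i.-1.

(* Taking some [B k] to be [setT] yields the product rule for subfamilies. *)
Definition mutually_independent (R : realType) (d : measure_display)
    (T : measurableType d) (P : probability T R) (n : nat)
    (X : 'I_n -> {RV P >-> R}) : Prop :=
  forall B : 'I_n -> set R, (forall k, measurable (B k)) ->
    P [set w | forall k, B k (X k w)] = (\prod_(k < n) P (X k @^-1` B k))%E.

Definition iid_uniform01 (R : realType) (d : measure_display)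
    (T : measurableType d) (P : probability T R) (n : nat)
    (X : 'I_n -> {RV P >-> R}) : Prop :=
  mutually_independent X /\
  forall k (A : set R), measurable A ->
    distribution P (X k) A = uniform_prob (@ltr01 R) A.

Definition local_level (R : realType) (d : measure_display)
    (T : measurableType d) (P : probability T R) (n : nat)
    (X : 'I_n -> {RV P >-> R}) (t : R) (i : nat) : \bar R :=
  P [set w | order_stat (fun k => X k w) i < hc_crit n i (hc_level t n)].

Definition loglog_growth (R : realType) (k : nat -> nat) : Prop :=
  ((k n)%:R / loglog R n @[n --> \oo] --> +oo /\
   (k n)%:R / loglog R n ^+ 3 @[n --> \oo] --> (0 : R)) \/
  (exists2 c : R, 0 < c & (k n)%:R / loglog R n ^+ 3 @[n --> \oo] --> c).

(* Main.v *)
Require Import Defs.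
From HB Require Import structures.
From mathcomp Require Import all_boot all_order all_algebra.
From mathcomp Require Import all_classical all_reals all_analysis.
From mathcomp Require Import ring lra.

(** Write u for loglog n, d for the level d_n(t), h for the critical value, and
    x = i - n h.  The value h is the root of (i - n h)^2 = d^2 n h (1 - h) with
    n h < i ([hc_crit_root]), so the local level is the probability that a
    binomial variable of parameters n and h ([prob_order_stat_lt]) exceeds its
    mean by at least d standard deviations, where d ~ sqrt (2 u) tends to
    infinity slowly.  It therefore equals the Gaussian tail
    exp (- d^2 / 2) / (sqrt (2 pi) d), corrected by the skewness of the binomial
    law.  The error allowed is a factor exp (o(zeta u)); when the rank is of order
    u^3 this is 1 + o(1), so even the constants must be exact.

    The Gaussian factor.  The number d is chosen so that
    exp (- d^2 / 2) / (sqrt (2 pi) d) is exp (- t) / (2 u ln n) up to 1 + o(1)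
    ([hc_level_gaussian_tail]): in d = (2 u + s) / sqrt (2 u) the shift s is
    negligible against sqrt u, so d^2 / 2 = u + s + o(1).

    The binomial tail.  A telescoping argument compares the tail with its first
    term, with the relative error 1 / d^2 and without any asymptotics
    ([binom_tail_le], [binom_tail_ge]).  Stirling's formula turns the logarithm
    of that first term into a relative entropy, whose expansion in the two
    ratios y = x / (n h) and z = x / (n (1 - h)) has the quadratic part d^2 / 2
    exactly, because h solves the quadratic equation; its cubic part contributes
    x (y^2 - z^2) / 6 to the logarithm of the tail, and the rest is at most
    2 x (y^3 + z^3) ([ln_binom_tail]).
    The constant sqrt (2 pi) of Stirling's formula comes from the Wallis
    integrals ([stirling]).

    The skewness.  Let m be i in case (a) and n - i in case (b).  The mean on the
    side of m, n h or n (1 - h), is equivalent to m because m / u tends to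
    infinity, and m is negligible against n because m = O(u^3).  So one of y and
    z is of order sqrt (2 u / m) and the other one is negligible against it, and
    x (y^2 - z^2) / 6 is equivalent to +- (sqrt 2 / 3) u sqrt (u / m), that is to
    (sqrt 2 / 3) zeta u, with the sign + in case (a) and - in case (b)
    ([cvg_skew_small], [cvg_skew_large], [cvg_skew_rem]).  Since m = O(u^3) also
    keeps u sqrt (u / m) away from 0, every o(1) is absorbed in o(zeta u), which
    is the error allowed in the exponent ([binom_tail_asymptotics]). *)

Import Order.TTheory GRing.Theory Num.Theory.
Import numFieldNormedType.Exports.

Local Open Scope classical_set_scope.
Local Open Scope ring_scope.

(** * Wallis integrals *)

Definition wallis (R : realType) (n : nat) : R :=
  \int[lebesgue_measure]_(x in `[0%R, pi / 2]) (cos x ^+ n).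

Lemma continuous_cosX (R : realType) n : continuous (fun x : R => cos x ^+ n).
Proof.
move=> x; apply: (@continuous_comp _ _ _ (@cos R) (fun y => y ^+ n)).
  exact: continuous_cos.
exact: exprn_continuous.
Qed.

Lemma integrable_cosX (R : realType) n :
  (@lebesgue_measure R).-integrable `[0%R, pi / 2] (EFin \o (fun x => cos x ^+ n)).
Proof.
apply: continuous_compact_integrable; first exact: segment_compact.
by apply: continuous_subspaceT; exact: continuous_cosX.
Qed.

Lemma pihalf_gt0 (R : realType) : 0 < pi / 2 :> R.
Proof. by rewrite divr_gt0// pi_gt0. Qed.

Lemma is_derive_cosX_sin (R : realType) n (x : R) :
  is_derive x 1 (fun y => cos y ^+ n.+1 * sin y)
    (n.+2%:R * cos x ^+ n.+2 - n.+1%:R * cos x ^+ n).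
Proof.
have -> : (fun y : R => cos y ^+ n.+1 * sin y) = ((@cos R) ^+ n.+1) * (@sin R).
  by apply/funext => y; rewrite !fctE.
apply: is_derive_eq.
rewrite /GRing.scale/= !fctE.
rewrite [in RHS](exprS _ n.+1) [in RHS](exprS _ n).
have h : sin x * sin x = 1 - cos x * cos x by rewrite -!expr2 sin2cos2.
rewrite [in LHS]exprS.
transitivity (cos x * cos x * cos x ^+ n - n.+1%:R * cos x ^+ n * (sin x * sin x)).
  by ring.
by rewrite h -!natr1; ring.
Qed.

(** The derivative of [cos ^+ n.+1 * sin] is a combination of [cos ^+ n.+2] and
    [cos ^+ n], and this function vanishes at both ends of the interval. *)
Lemma wallis_rec (R : realType) n :
  n.+2%:R * wallis R n.+2 = n.+1%:R * wallis R n.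
Proof.
apply/eqP; rewrite -subr_eq0.
rewrite /wallis -!RintegralZl; [|exact: measurable_itv|exact: integrable_cosX|
  exact: measurable_itv|exact: integrable_cosX].
have zi k m : lebesgue_measure.-integrable `[0%R, pi / 2]
    (EFin \o (fun x : R => k%:R * cos x ^+ m)).
  exact: (integrableZl _ _ (integrable_cosX R m)).
rewrite -RintegralB//.
rewrite /Rintegral (@continuous_FTC2 _ _ (fun x => cos x ^+ n.+1 * sin x)).
- by rewrite cos_pihalf sin0 expr0n/= mul0r mulr0 subrr eqxx.
- exact: pihalf_gt0.
- apply: continuous_subspaceT => x.
  by apply: cvgB; apply: cvgMr; exact: continuous_cosX.
- have ct : continuous (fun x : R => cos x ^+ n.+1 * sin x).
    by move=> x; apply: cvgM; [exact: continuous_cosX|exact: continuous_sin].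
  split; first by move=> x _; case: (is_derive_cosX_sin R n x).
    by apply: cvg_at_right_filter; exact: ct.
  by apply: cvg_at_left_filter; exact: ct.
- by move=> x _; rewrite derive1E; apply: derive_val; exact: is_derive_cosX_sin.
Qed.

Lemma wallis0 (R : realType) : wallis R 0 = pi / 2.
Proof.
rewrite /wallis /Rintegral (@continuous_FTC2 _ _ id).
- by rewrite -EFinB subr0.
- exact: pihalf_gt0.
- by apply: continuous_subspaceT; exact: continuous_cosX.
- split; first by move=> x _; exact: derivable_id.
    by apply: cvg_at_right_filter; exact: cvg_id.
  by apply: cvg_at_left_filter; exact: cvg_id.
- by move=> x _; rewrite derive1E derive_val expr0.
Qed.

Lemma wallis1 (R : realType) : wallis R 1 = 1.
Proof.
rewrite /wallis /Rintegral (@continuous_FTC2 _ _ (@sin R)).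
- by rewrite sin_pihalf sin0 -EFinB subr0.
- exact: pihalf_gt0.
- by apply: continuous_subspaceT; exact: continuous_cosX.
- split; first by move=> x _; exact: derivable_sin.
    by apply: cvg_at_right_filter; exact: continuous_sin.
  by apply: cvg_at_left_filter; exact: continuous_sin.
- by move=> x _; rewrite derive1E derive_val.
Qed.

Lemma wallis_dec (R : realType) n : wallis R n.+1 <= wallis R n.
Proof.
apply: le_Rintegral; [exact: measurable_itv|exact: integrable_cosX..|].
move=> x; rewrite /= in_itv/= => /andP[x0 x1].
have c0 : 0 <= cos x.
  apply: cos_ge0_pihalf; rewrite x1 andbT (le_trans _ x0)//.
  by rewrite oppr_le0 ltW// pihalf_gt0.
by rewrite exprS ler_piMl ?exprn_ge0// cos_le1.
Qed.

(** By [wallis_rec] this product does not depend on [n]. *)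
Lemma wallis_mul (R : realType) n :
  n.+1%:R * (wallis R n * wallis R n.+1) = pi / 2.
Proof.
elim: n => [|n IH]; first by rewrite wallis0 wallis1; ring.
by rewrite mulrCA wallis_rec -IH; ring.
Qed.

(** Cleared of denominators, this is the central binomial coefficient: it links
    factorials to [pi]. *)
Lemma wallis_even (R : realType) n :
  wallis R n.*2 * (4 ^+ n * n`!%:R ^+ 2) = pi / 2 * (n.*2)`!%:R.
Proof.
elim: n => [|n IH]; first by rewrite wallis0 expr0 expr1n !mulr1.
have n2 : n.*2.+2%:R != 0 :> R by rewrite pnatr_eq0.
apply: (mulfI n2); rewrite doubleS [LHS]mulrA wallis_rec.
rewrite !factS !natrM exprS -mul2n.
  transitivity ((n.*2.+1%:R * n.*2.+2%:R * n.*2.+2%:R) *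
    (wallis R n.*2 * (4 ^+ n * n`!%:R ^+ 2))).
  rewrite -mul2n -!natr1 natrM; ring.
by rewrite IH -mul2n; ring.
Qed.

Lemma wallis_gt0 (R : realType) n : 0 < wallis R n.
Proof.
have w0 m : 0 <= wallis R m.
  apply: Rintegral_ge0 => x; rewrite /= in_itv/= => /andP[x0 x1].
  rewrite exprn_ge0// cos_ge0_pihalf// x1 andbT (le_trans _ x0)//.
  by rewrite oppr_le0 ltW// pihalf_gt0.
rewrite lt_neqAle w0 andbT eq_sym; apply/eqP => w.
have := wallis_mul R n; rewrite w mul0r mulr0 => /esym/eqP.
by rewrite gt_eqF// pihalf_gt0.
Qed.

(** The integrals decrease, so the square of one of them lies between its
    products with its two neighbours, which [wallis_mul] evaluates. *)
Lemma wallis_sqr_bounds (R : realType) n :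
  pi / 2 / n.+2%:R <= wallis R n.+1 ^+ 2 <= pi / 2 / n.+1%:R.
Proof.
apply/andP; split.
  rewrite ler_pdivrMr// -(wallis_mul R n.+1) mulrC ler_pM2r//.
  by rewrite expr2 ler_pM2l ?wallis_gt0// wallis_dec.
rewrite ler_pdivlMr// -(wallis_mul R n) mulrC ler_pM2l//.
by rewrite expr2 ler_pM2r ?wallis_gt0// wallis_dec.
Qed.

(** * Taylor bounds for the logarithm *)

(** The mean value theorem between [0] and a point [y] of either sign; the
    condition [0 <= c * y] says that [c] lies on the same side as [y]. *)
Lemma MVT_0 (R : realType) (f df : R -> R) (y : R) :
  (forall x : R, `|x| <= `|y| -> 0 <= x * y -> is_derive x 1 f (df x)) ->
  f 0 = 0 ->
  exists c, [/\ `|c| <= `|y|, 0 <= c * y & f y = df c * y].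
Proof.
move=> fd f0.
have cf (a b : R) : (forall x : R, x \in `[a, b] -> `|x| <= `|y| /\ 0 <= x * y) ->
    {within `[a, b], continuous f}.
  move=> ab; apply: derivable_within_continuous => x /ab [/fd /[apply]].
  by case.
have [y0|y0] := leP 0 y.
  have iy (x : R) : x \in `[0, y] -> `|x| <= `|y| /\ 0 <= x * y.
    by rewrite in_itv/= => /andP[x0 xy]; rewrite !ger0_norm// mulr_ge0.
  have [|c cy] := @MVT_segment _ f df _ _ y0 _ (cf _ _ iy).
    by move=> x /subset_itv_oo_cc /iy [/fd /[apply]].
  rewrite f0 !subr0 => ->; exists c.
  by have [? ?] := iy _ cy.
have iy (x : R) : x \in `[y, 0] -> `|x| <= `|y| /\ 0 <= x * y.
  rewrite in_itv/= => /andP[x0 xy].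
  by rewrite !ler0_norm ?lerN2 ?mulr_le0// ltW.
have [|c cy] := @MVT_segment _ f df _ _ (ltW y0) _ (cf _ _ iy).
  by move=> x /subset_itv_oo_cc /iy [/fd /[apply]].
rewrite f0 !sub0r mulrN => /oppr_inj ->; exists c.
by have [? ?] := iy _ cy.
Qed.

Lemma is_derive_ln1D (R : realType) (x : R) : -1 < x ->
  is_derive x 1 (fun y => ln (1 + y)) (1 + x)^-1.
Proof.
move=> x1; have p : 0 < 1 + x by lra.
have h := is_derive1_ln p.
have -> : (1 + x)^-1 = (1 + x)^-1 *: (1 : R) by rewrite /GRing.scale/= mulr1.
apply: is_derive1_comp.
by apply: is_derive_eq; rewrite add0r.
Qed.

(** At [y = n^-1] the rational function is [(n + 1 / 2)^-1], so that the
    difference, multiplied by [n + 1 / 2], is the decrement of the error term in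
    Stirling's formula.  Its derivative is
    [y ^+ 2 / ((1 + y) * (2 + y) ^+ 2)], which lies between [0] and [y ^+ 2]. *)
Lemma ln1D_rational_bounds (R : realType) (y : R) : 0 < y ->
  0 <= ln (1 + y) - 2 * y / (2 + y) <= y ^+ 3.
Proof.
move=> y0.
pose f := (fun x : R => ln (1 + x)) -
  ((cst 2 : R -> R) * id) * (fun x : R => (2 + x)^-1).
have [x _||c []] := @MVT_0 R f (fun y => y ^+ 2 / ((1 + y) * (2 + y) ^+ 2)) y.
- rewrite pmulr_lge0// => x0.
  have h1 : is_derive x 1 (fun y => ln (1 + y)) (1 + x)^-1.
    by apply: is_derive_ln1D; lra.
  have h2 : is_derive x 1 (fun y => (2 + y)^-1) (- (2 + x) ^- 2 *: 1).
    apply: is_deriveV; first by rewrite gt_eqF//; lra.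
    by apply: is_derive_eq; rewrite add0r.
  rewrite /f; apply: is_derive_eq.
  rewrite /GRing.scale/= !fctE.
  by field; rewrite !gt_eqF//; lra.
- by rewrite /f !fctE addr0 ln1 mulr0 mul0r subr0.
rewrite pmulr_lge0// => /[swap] c0.
rewrite (ger0_norm c0) (gtr0_norm y0) => cy.
rewrite /f !fctE => ->.
have d1 : 1 <= (1 + c) * (2 + c) ^+ 2.
  by rewrite -[leLHS]mulr1 ler_pM ?exprn_ege1//; lra.
have d0 := lt_le_trans ltr01 d1.
rewrite mulr_ge0 ?divr_ge0 ?exprn_ge0 ?(ltW d0) ?(ltW y0)//=.
rewrite [leRHS]exprSr ler_wpM2r ?(ltW y0)//.
rewrite ler_pdivrMr// (@le_trans _ _ (y ^+ 2))//.
  by rewrite ler_sqr ?nnegrE// ltW.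
by rewrite ler_peMr// exprn_ge0// ltW.
Qed.

(** Two applications of the mean value theorem: the derivative of the left-hand
    function is [ln (1 + y) - y + y ^+ 2 / 2], whose own derivative
    [y ^+ 2 / (1 + y)] is at most [2 * y ^+ 2]. *)
Lemma ln1D_cubic_bound (R : realType) (y : R) : `|y| <= 2^-1 ->
  `|(1 + y) * ln (1 + y) - y - y ^+ 2 / 2 + y ^+ 3 / 6| <= 2 * y ^+ 4.
Proof.
move=> y12.
have d1 (x : R) : `|x| <= 2^-1 ->
    is_derive x 1 (fun y => ln (1 + y)) (1 + x)^-1.
  rewrite ler_norml => /andP[x1 x2]; apply: is_derive_ln1D; lra.
have bound (x : R) : `|x| <= 2^-1 -> `|ln (1 + x) - x + x ^+ 2 / 2| <= 2 * `|x| ^+ 3.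
  move=> x12.
  pose f := (fun x : R => ln (1 + x)) - id + (cst 2^-1 : R -> R) * (@GRing.exp R ^~ 2).
  have [z zx _||c [cx _]] := @MVT_0 R f (fun x => x ^+ 2 / (1 + x)) x.
  - have h1 := d1 _ (le_trans zx x12).
    have : 0 < 1 + z by have := le_trans zx x12; rewrite ler_norml => /andP[]; lra.
    move=> z0; rewrite /f; apply: is_derive_eq.
    rewrite /GRing.scale/=.
    by field; rewrite gt_eqF.
  - by rewrite /f !fctE addr0 ln1 expr0n/=; ring.
  rewrite /f !fctE => fE.
  have -> : ln (1 + x) - x + x ^+ 2 / 2 = c ^+ 2 / (1 + c) * x by rewrite -fE; ring.
  have c1 : 2^-1 <= 1 + c by have := le_trans cx x12; rewrite ler_norml => /andP[]; lra.
  rewrite normrM [in leRHS]exprSr mulrA ler_wpM2r// normrM normrX.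
  have c2 : 0 < 1 + c by lra.
  rewrite normfV (gtr0_norm c2) ler_pdivrMr//.
  apply: (@le_trans _ _ (`|x| ^+ 2)); first by rewrite ler_sqr.
  by rewrite mulrAC ler_peMl ?exprn_ge0//; lra.
pose f := ((cst 1 : R -> R) + id) * (fun x : R => ln (1 + x)) - id -
  (cst 2^-1 : R -> R) * (@GRing.exp R ^~ 2) + (cst 6^-1 : R -> R) * (@GRing.exp R ^~ 3).
have [z zy _||c [cy _]] := @MVT_0 R f (fun x => ln (1 + x) - x + x ^+ 2 / 2) y.
- have h1 := d1 _ (le_trans zy y12).
  have : 0 < 1 + z by have := le_trans zy y12; rewrite ler_norml => /andP[]; lra.
  move=> z0; rewrite /f; apply: is_derive_eq.
  rewrite /GRing.scale/= !fctE.
  by field; rewrite gt_eqF.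
- by rewrite /f !fctE addr0 ln1 !expr0n/=; ring.
rewrite /f !fctE => fE.
have -> : (1 + y) * ln (1 + y) - y - y ^+ 2 / 2 + y ^+ 3 / 6 =
  (ln (1 + c) - c + c ^+ 2 / 2) * y by rewrite -fE; ring.
have -> : y ^+ 4 = `|y| ^+ 4 by rewrite -normrX ger0_norm// exprn_even_ge0.
rewrite normrM [in leRHS]exprSr mulrA ler_wpM2r//.
apply: le_trans (bound _ (le_trans cy y12)) _.
by rewrite ler_pM2l// lerXn2r ?nnegrE.
Qed.

(** * Stirling's formula *)

Definition stirling_rem (R : realType) (n : nat) : R :=
  ln n`!%:R - (n%:R * ln n%:R - n%:R + ln n%:R / 2).

Lemma stirling_rem_step (R : realType) n : let x : R := n.+1%:R in
  stirling_rem R n.+1 - stirling_rem R n.+2 =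
  (x + 2^-1) * (ln (1 + x^-1) - 2 * x^-1 / (2 + x^-1)).
Proof.
move=> x; have x0 : 0 < x by rewrite ltr0n.
have -> : ln (1 + x^-1) = ln (x + 1) - ln x.
  by rewrite -ln_div ?posrE ?addr_gt0//; congr ln; field; rewrite gt_eqF.
rewrite /stirling_rem [in n.+2`!]factS natrM lnM ?posrE ?ltr0n ?fact_gt0//.
have -> : n.+2%:R = x + 1 :> R by rewrite /x natr1.
rewrite -/x.
have -> : 2 * x^-1 / (2 + x^-1) = (x + 2^-1)^-1.
  by field; rewrite !gt_eqF//; lra.
by field; rewrite gt_eqF//; lra.
Qed.

(** The lower bound makes the remainder nonincreasing; the upper bound
    telescopes, which keeps the remainder bounded below. *)
Lemma stirling_rem_step_bounds (R : realType) n :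
  0 <= stirling_rem R n.+1 - stirling_rem R n.+2 <=
    3 * (n.+1%:R^-1 - n.+2%:R^-1).
Proof.
rewrite stirling_rem_step.
set x : R := n.+1%:R.
have x1 : 1 <= x by rewrite ler1n.
have x0 : 0 < x by lra.
have xi : 0 < x^-1 by rewrite invr_gt0.
have /andP[b1 b2] := ln1D_rational_bounds R _ xi.
rewrite mulr_ge0//=; last by lra.
apply: (@le_trans _ _ ((x + 2^-1) * x^-1 ^+ 3)).
  by rewrite ler_pM2l//; lra.
have -> : n.+2%:R = x + 1 :> R by rewrite /x natr1.
have -> : 3 * (x^-1 - (x + 1)^-1) = (3 * x ^+ 2) / (x + 1) * x^-1 ^+ 3.
  by field; rewrite !gt_eqF//; lra.
rewrite ler_pM2r ?exprn_gt0// ler_pdivlMr; last lra.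
nra.
Qed.

Lemma stirling_rem_is_cvg (R : realType) : cvgn (fun n => stirling_rem R n.+1).
Proof.
apply: nonincreasing_is_cvgn.
  apply/nonincreasing_seqP => n.
  by have /andP[] := stirling_rem_step_bounds R n; rewrite subr_ge0.
exists (stirling_rem R 1 - 3); move=> _ [n _ <-] /=.
suff : stirling_rem R 1 - 3 <= stirling_rem R n.+1 - 3 * n.+1%:R^-1.
  have : 0 < n.+1%:R^-1 :> R by rewrite invr_gt0.
  by move: (n.+1%:R^-1) (stirling_rem R n.+1) => y z; lra.
elim: n => [|n IH]; first by rewrite invr1 mulr1.
have /andP[_] := stirling_rem_step_bounds R n.
by move: IH; move: (n.+1%:R^-1) (n.+2%:R^-1) => y z; lra.
Qed.

(** In this combination the factorials appear only through the central binomial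
    coefficient, that is through [wallis R n.+1.*2]; this identifies the limit of
    the remainder. *)
Lemma stirling_rem_wallis (R : realType) n :
  `|2 * stirling_rem R n.+1 - stirling_rem R n.+1.*2 - ln (2 * pi) / 2|
    <= n.+1%:R^-1.
Proof.
set x : R := n.+1%:R.
have x1 : 1 <= x by rewrite ler1n.
have x0 : 0 < x by lra.
have fac k : 0 < k`!%:R :> R by rewrite ltr0n fact_gt0.
have pi0 := @pi_gt0 R.
have W := wallis_gt0 R n.+1.*2.
have lnW : ln (wallis R n.+1.*2) + (n.+1%:R * (ln 2 * 2) + 2 * ln n.+1`!%:R)
    = ln pi - ln 2 + ln (n.+1.*2)`!%:R.
  have := congr1 (@ln R) (wallis_even R n.+1).
  rewrite !lnM ?posrE ?invr_gt0 ?mulr_gt0 ?exprn_gt0//.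
  rewrite lnV ?posrE// lnXn//.
  have -> : ln 4 = ln 2 *+ 2 :> R by rewrite -lnXn//; congr ln; ring.
  rewrite -[_ *+ n.+1]mulr_natl -[ln 2 *+ 2]mulr_natl -/x.
  lra.
have : ln (pi / 2 / (2 * x + 1)) <= 2 * ln (wallis R n.+1.*2) <=
    ln (pi / 2 / (2 * x)).
  have -> : 2 * ln (wallis R n.+1.*2) = ln (wallis R n.+1.*2 ^+ 2).
    by rewrite lnXn// mulr_natl.
  have := wallis_sqr_bounds R n.*2.+1.
  have -> : n.*2.+3%:R = 2 * x + 1 :> R.
    by rewrite /x -natrM natr1 mul2n doubleS.
  have -> : n.*2.+2%:R = 2 * x :> R by rewrite /x -natrM mul2n doubleS.
  have W2 : 0 < wallis R n.*2.+2 ^+ 2 by rewrite exprn_gt0// wallis_gt0.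
  have P1 : 0 < pi / 2 / (2 * x + 1) :> R by rewrite !divr_gt0//; lra.
  have P2 : 0 < pi / 2 / (2 * x) :> R by rewrite !divr_gt0//; lra.
  by rewrite doubleS !ler_ln ?posrE.
rewrite !ln_div ?posrE ?divr_gt0//; [|lra..].
have : ln (2 * x + 1) <= ln (2 * x) + (2 * x)^-1.
  have -> : 2 * x + 1 = (2 * x) * (1 + (2 * x)^-1) by field; rewrite gt_eqF.
  have : 0 < (2 * x)^-1 by rewrite invr_gt0 mulr_gt0.
  move=> h; rewrite lnM ?posrE ?mulr_gt0 ?addr_gt0//.
  by rewrite lerD2l le_ln1Dx// (lt_trans _ h)// ltrN10.
rewrite /stirling_rem.
have -> : n.+1.*2%:R = 2 * x :> R by rewrite /x -natrM mul2n.
rewrite -/x !lnM ?posrE//; [|lra..].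
have : (2 * x)^-1 <= x^-1 by rewrite lef_pV2 ?posrE; lra.
move: lnW; rewrite -/x.
move: (ln _) => lw; move: ((2 * x)^-1) (x^-1) => v w.
move=> lnW h1 h2 /andP[h3 h4].
rewrite ler_norml; apply/andP; split; lra.
Qed.

(** The remainder converges to some [l], and [2 * l - l] is given by
    [stirling_rem_wallis]. *)
Lemma stirling (R : realType) :
  stirling_rem R n @[n --> \oo] --> ln (2 * pi) / 2.
Proof.
rewrite -(cvg_shiftS (stirling_rem R)).
have := stirling_rem_is_cvg R.
move=> /cvg_ex[l /= sl].
suff <- : l = ln (2 * pi) / 2 by [].
have sl' : stirling_rem R n @[n --> \oo] --> l by rewrite -cvg_shiftS.
have s2 : stirling_rem R n.+1.*2 @[n --> \oo] --> l.
  apply: (cvg_comp (fun n => n.+1.*2) (stirling_rem R) _ sl').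
  apply/cvgnyPge => A; near=> n.
  rewrite (@leq_trans n)//; first by near: n; exact: nbhs_infty_ge.
  by rewrite -addnn addSn ltnW// ltnS leq_addr.
have h : (2 * stirling_rem R n.+1 - stirling_rem R n.+1.*2 - ln (2 * pi) / 2)
   @[n --> \oo] --> 2 * l - l - ln (2 * pi) / 2.
  apply: cvgB; last exact: cvg_cst.
  by apply: cvgB => //; apply: cvgMl_tmp.
have h0 : (2 * stirling_rem R n.+1 - stirling_rem R n.+1.*2 - ln (2 * pi) / 2)
   @[n --> \oo] --> 0.
  apply/norm_cvg0P; apply: (squeeze_cvgr _ (cvg_cst 0) cvg_harmonic).
  by apply: nearW => n; rewrite normr_ge0 stirling_rem_wallis.
have e : 2 * l - l - ln (2 * pi) / 2 = 0 by exact: (cvg_unique _ h h0).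
by apply/eqP; rewrite -subr_eq0 -e; apply/eqP; ring.
Unshelve. all: by end_near. Qed.

(** * Upper tails of the binomial law *)

Definition binom_mass (R : realType) (n : nat) (h : R) (k : nat) : R :=
  'C(n, k)%:R * (h ^+ k * (1 - h) ^+ (n - k)).

Definition binom_tail (R : realType) (n : nat) (h : R) (i : nat) : R :=
  \sum_(i <= k < n.+1) binom_mass R n h k.

Lemma binom_mass_ge0 (R : realType) n (h : R) k :
  0 <= h <= 1 -> 0 <= binom_mass R n h k.
Proof.
move=> /andP[h0 h1].
by rewrite mulr_ge0// mulr_ge0// exprn_ge0// subr_ge0.
Qed.

(** At [k = n] both sides vanish. *)
Lemma binom_mass_rec (R : realType) n (h : R) k : (k <= n)%N ->
  k.+1%:R * (1 - h) * binom_mass R n h k.+1 =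
  (n%:R - k%:R) * h * binom_mass R n h k.
Proof.
rewrite leq_eqVlt /binom_mass => /predU1P[->|kn].
  by rewrite bin_small// mul0r mulr0 subrr !mul0r.
have e : k.+1%:R * 'C(n, k.+1)%:R = (n%:R - k%:R) * 'C(n, k)%:R :> R.
  by rewrite -natrB ?(ltnW kn)// -!natrM mul_bin_left.
have -> : (n - k = (n - k.+1).+1)%N by rewrite subnSK.
rewrite !exprS.
transitivity ((k.+1%:R * 'C(n, k.+1)%:R) *
  ((1 - h) * h * h ^+ k * (1 - h) ^+ (n - k.+1))); first by ring.
by rewrite e; ring.
Qed.

(** By [binom_mass_rec], [k * (1 - h) * binom_mass R n h k] telescopes: its
    decrease from [k] to [k.+1] is [(k - n * h) * binom_mass R n h k], and
    [k - n * h] is at least [i - n * h] on the tail. *)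
Lemma binom_tail_le (R : realType) n (h : R) i : 0 <= h <= 1 -> (i <= n)%N ->
  n%:R * h < i%:R ->
  binom_tail R n h i <=
    i%:R * (1 - h) * binom_mass R n h i / (i%:R - n%:R * h).
Proof.
move=> h01 i_n hi; rewrite ler_pdivlMr ?subr_gt0//.
pose G k := - (k%:R * (1 - h) * binom_mass R n h k).
have -> : i%:R * (1 - h) * binom_mass R n h i = G n.+1 - G i.
  by rewrite /G [binom_mass _ _ _ n.+1]/binom_mass bin_small// mul0r mulr0; ring.
rewrite -telescope_sumr 1?leqW// mulr_suml.
rewrite !big_nat; apply: ler_sum => k /andP[ik]; rewrite ltnS => kn.
rewrite /G binom_mass_rec//.
have -> : - ((n%:R - k%:R) * h * binom_mass R n h k) -
   - (k%:R * (1 - h) * binom_mass R n h k) =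
   binom_mass R n h k * (k%:R - n%:R * h) by ring.
by rewrite ler_wpM2l ?binom_mass_ge0// lerD2r ler_nat.
Qed.

(** The converse of [binom_tail_le].  Dividing the telescoping quantity by
    [k - n * h + dl] turns its decrease into a lower bound for
    [binom_mass R n h k] as soon as [dl * x] is at least the variance
    [n * h * (1 - h)]. *)
Lemma binom_tail_ge (R : realType) n (h : R) i (x : R) :
  0 <= h <= 1 -> (i <= n)%N -> x = i%:R - n%:R * h -> 0 < x ->
  i%:R * (1 - h) * binom_mass R n h i / (x + n%:R * h * (1 - h) / x)
    <= binom_tail R n h i.
Proof.
move=> h01 i_n xE x0.
set V := n%:R * h * (1 - h).
have V0 : 0 <= V by case/andP: h01 => ? ?; rewrite !mulr_ge0// subr_ge0.
pose dl := V / x; rewrite -/dl.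
have dl0 : 0 <= dl by rewrite divr_ge0// ltW.
have Vdl : V = dl * x by rewrite /dl divfK// gt_eqF.
pose G k := - (k%:R * (1 - h) * binom_mass R n h k / (k%:R - n%:R * h + dl)).
have -> : i%:R * (1 - h) * binom_mass R n h i / (x + dl) = G n.+1 - G i.
  rewrite /G [binom_mass _ _ _ n.+1]/binom_mass bin_small// !mul0r mulr0 mul0r -xE.
  by ring.
rewrite -telescope_sumr 1?leqW//.
rewrite /binom_tail !big_nat; apply: ler_sum => k /andP[ik]; rewrite ltnS => kn.
rewrite /G binom_mass_rec//.
set y : R := k%:R - n%:R * h.
have xy : x <= y by rewrite xE lerD2r ler_nat.
have y0 := lt_le_trans x0 xy.
have -> : k.+1%:R - n%:R * h + dl = y + dl + 1 by rewrite /y -natr1; ring.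
set b := binom_mass _ _ _ _.
have b0 : 0 <= b by rewrite binom_mass_ge0.
have -> : - ((n%:R - k%:R) * h * b / (y + dl + 1)) - - (k%:R * (1 - h) * b / (y + dl))
   = b * ((V + y * (1 - h) + y * (y + dl)) / ((y + dl) * (y + dl + 1))).
  have -> : k%:R = y + n%:R * h by rewrite /y; ring.
  by rewrite /V; field; rewrite !gt_eqF//; lra.
rewrite ler_piMr// ler_pdivrMr ?mulr_gt0//; [|lra..].
rewrite mul1r Vdl.
have h1 : 0 <= h by case/andP: h01.
have : dl * x <= dl * y by rewrite ler_wpM2l.
have : 0 <= y * h by rewrite mulr_ge0// ltW.
have : 0 <= dl * dl by rewrite mulr_ge0.
nra.
Qed.

(** The contribution of the error terms of Stirling's formula to the logarithm
    of a binomial coefficient. *)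
Definition stirling_err (R : realType) n i : R :=
  stirling_rem R n - stirling_rem R i - stirling_rem R (n - i).

(** The last two terms are the relative entropy of the frequency [i / n] with
    respect to [h], multiplied by [- n]: indeed [1 + y] and [1 - z] are the ratios
    of [i] and [n - i] to their expected values. *)
Lemma ln_binom_mass (R : realType) n i (h : R) : (0 < i < n)%N -> 0 < h < 1 ->
  let x := i%:R - n%:R * h in
  let y := x / (n%:R * h) in let z := x / (n%:R * (1 - h)) in
  ln (binom_mass R n h i) = stirling_err R n i +
    (ln n%:R - ln i%:R - ln (n - i)%:R) / 2
    - i%:R * ln (1 + y) - (n - i)%:R * ln (1 - z).
Proof.
move=> /andP[i0 i_n] /andP[h0 h1] x y z.
have I0 : 0 < i%:R :> R by rewrite ltr0n.
have N0 : 0 < n%:R :> R by rewrite ltr0n (leq_trans i0)// ltnW.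
have J0 : 0 < (n - i)%:R :> R by rewrite ltr0n subn_gt0.
have h1' : 0 < 1 - h by rewrite subr_gt0.
have iE : i%:R = n%:R * h * (1 + y) by rewrite /y /x; field; rewrite !gt_eqF.
have jE : (n - i)%:R = n%:R * (1 - h) * (1 - z).
  by rewrite natrB ?(ltnW i_n)// /z /x; field; rewrite !gt_eqF.
have y0 : 0 < 1 + y by rewrite -(@pmulr_rgt0 _ (n%:R * h)) -?iE ?mulr_gt0.
have z0 : 0 < 1 - z by rewrite -(@pmulr_rgt0 _ (n%:R * (1 - h))) -?jE ?mulr_gt0.
have lnI : ln i%:R = ln n%:R + ln h + ln (1 + y).
  by rewrite {1}iE !lnM ?posrE ?mulr_gt0.
have lnJ : ln (n - i)%:R = ln n%:R + ln (1 - h) + ln (1 - z).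
  by rewrite {1}jE !lnM ?posrE ?mulr_gt0.
rewrite /binom_mass !lnM ?posrE ?mulr_gt0 ?exprn_gt0 ?ltr0n ?bin_gt0 ?(ltnW i_n)//.
rewrite !lnXn//.
have fac k : 0 < k`!%:R :> R by rewrite ltr0n fact_gt0.
have : ln ('C(n, i)%:R) + (ln i`!%:R + ln (n - i)`!%:R) = ln n`!%:R :> R.
  rewrite -!lnM ?posrE ?mulr_gt0 ?fac// ?ltr0n ?bin_gt0 ?(ltnW i_n)//.
  by rewrite -!natrM bin_fact// ltnW.
have nE : n%:R = i%:R + (n - i)%:R :> R by rewrite -natrD subnKC// ltnW.
rewrite /stirling_err /stirling_rem lnI lnJ.
rewrite -[ln h *+ i]mulr_natl -[ln (1 - h) *+ _]mulr_natl => hC.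
have -> : ln 'C(n, i)%:R = ln n`!%:R - ln i`!%:R - ln (n - i)`!%:R :> R.
  by rewrite -hC; ring.
by rewrite [X in X * ln n%:R]nE [X in _ - X + ln n%:R / 2]nE; ring.
Qed.

(** When [x] is [d] standard deviations, the variance divided by [x] is
    [x / d ^+ 2], so the bounds [binom_tail_le] and [binom_tail_ge] differ by the
    factor [1 + d ^- 2]. *)
Lemma ln_binom_tail_mass (R : realType) n i (h d : R) :
  (0 < i < n)%N -> 0 < h < 1 -> 0 < d ->
  let x : R := i%:R - n%:R * h in
  0 < x -> x ^+ 2 = d ^+ 2 * (n%:R * h * (1 - h)) ->
  0 < binom_tail R n h i /\
  `|ln (binom_tail R n h i) -
     (ln i%:R + ln (1 - h) + ln (binom_mass R n h i) - ln x)| <= d ^- 2.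
Proof.
move=> /andP[i0 i_n] /andP[h0 h1] d0 x x0 xd.
have h1' : 0 < 1 - h by rewrite subr_gt0.
have I0 : 0 < i%:R :> R by rewrite ltr0n.
have b0 : 0 < binom_mass R n h i.
  by rewrite /binom_mass !mulr_gt0 ?exprn_gt0// ltr0n bin_gt0 ltnW.
have h01 : 0 <= h <= 1 by rewrite !ltW.
have up : binom_tail R n h i <= i%:R * (1 - h) * binom_mass R n h i / x.
  by apply: binom_tail_le => //; [exact: ltnW|rewrite -subr_gt0].
have lo := binom_tail_ge R n h i x h01 (ltnW i_n) erefl x0.
move: (binom_mass R n h i) b0 up lo => b b0.
set w : R := i%:R * (1 - h) * b => up lo.
have w0 : 0 < w by rewrite !mulr_gt0.
have xE : x + n%:R * h * (1 - h) / x = x * (1 + d ^- 2).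
  have -> : n%:R * h * (1 - h) = x ^+ 2 / d ^+ 2.
    by rewrite xd; field; rewrite gt_eqF.
  by field; rewrite !gt_eqF.
have d2 : 0 < d ^- 2 by rewrite invr_gt0 exprn_gt0.
have d2' : 0 < 1 + d ^- 2 by rewrite addr_gt0.
rewrite xE in lo.
have S0 : 0 < binom_tail R n h i.
  by apply: lt_le_trans lo; rewrite divr_gt0// mulr_gt0.
split => //.
have -> : ln i%:R + ln (1 - h) + ln b - ln x = ln (w / x).
  by rewrite ln_div ?posrE// /w !lnM ?posrE ?mulr_gt0.
have wx : 0 < w / x by rewrite divr_gt0.
have up' : ln (binom_tail R n h i) <= ln (w / x) by rewrite ler_ln.
have lo' : ln (w / x) - ln (1 + d ^- 2) <= ln (binom_tail R n h i).
  rewrite -ln_div ?posrE// ler_ln ?posrE ?divr_gt0//.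
  apply: le_trans lo; rewrite le_eqVlt; apply/orP; left; apply/eqP.
  by field; rewrite !gt_eqF//= addr_gt0// exprn_gt0.
have l1 : ln (1 + d ^- 2) <= d ^- 2 by rewrite le_ln1Dx// (lt_trans _ d2)// ltrN10.
by rewrite ler_norml; apply/andP; split; lra.
Qed.

(** Expanding [(1 + y) * ln (1 + y)] and [(1 - z) * ln (1 - z)] to the third
    order.  Since [n * h * y = n * (1 - h) * z = x], the linear terms cancel, the
    quadratic ones add up to [x * (y + z) / 2 = d ^+ 2 / 2], and the factors in
    front of the exponential combine to [d^-1] and the two logarithms that are
    halved. *)
Lemma ln_binom_tail (R : realType) n i (h d : R) :
  (0 < i < n)%N -> 0 < h < 1 -> 0 < d ->
  let x : R := i%:R - n%:R * h in
  let y : R := x / (n%:R * h) in let z : R := x / (n%:R * (1 - h)) in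
  0 < x -> x ^+ 2 = d ^+ 2 * (n%:R * h * (1 - h)) -> y <= 2^-1 -> z <= 2^-1 ->
  `|ln (binom_tail R n h i) -
     (stirling_err R n i - ln d - d ^+ 2 / 2 + (ln (1 + y) - ln (1 - z)) / 2
      + x * (y ^+ 2 - z ^+ 2) / 6)| <= 2 * x * (y ^+ 3 + z ^+ 3) + d ^- 2.
Proof.
move=> i_n h01 d0 x y z x0 xd y12 z12.
have [_] := ln_binom_tail_mass R n i h d i_n h01 d0 x0 xd.
rewrite (ln_binom_mass R n i h i_n h01) -/x -/y -/z.
case/andP: i_n => i0 i_n; case/andP: h01 => h0 h1.
have I0 : 0 < i%:R :> R by rewrite ltr0n.
have N0 : 0 < n%:R :> R by rewrite ltr0n (leq_trans i0)// ltnW.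
have h1' : 0 < 1 - h by rewrite subr_gt0.
have a0 : 0 < n%:R * h by rewrite mulr_gt0.
have c0 : 0 < n%:R * (1 - h) by rewrite mulr_gt0.
have y0 : 0 < y by rewrite divr_gt0.
have z0 : 0 < z by rewrite divr_gt0.
have iE : i%:R = n%:R * h * (1 + y) by rewrite /y /x; field; rewrite !gt_eqF.
have jE : (n - i)%:R = n%:R * (1 - h) * (1 - z).
  by rewrite natrB ?(ltnW i_n)// /z /x; field; rewrite !gt_eqF.
have y1 : 0 < 1 + y by lra.
have z1 : 0 < 1 - z by lra.
have lnI : ln i%:R = ln n%:R + ln h + ln (1 + y).
  by rewrite {1}iE !lnM ?posrE ?mulr_gt0.
have lnJ : ln (n - i)%:R = ln n%:R + ln (1 - h) + ln (1 - z).
  by rewrite {1}jE !lnM ?posrE ?mulr_gt0.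
have lnx : ln x = ln d + (ln n%:R + ln h + ln (1 - h)) / 2.
  have : ln (x ^+ 2) = ln (d ^+ 2 * (n%:R * h * (1 - h))) by rewrite xd.
  rewrite lnXn// lnM ?posrE ?mulr_gt0 ?exprn_gt0// lnXn// !lnM ?posrE ?mulr_gt0//.
  rewrite -[ln x *+ 2]mulr_natl -[ln d *+ 2]mulr_natl; lra.
have := ln1D_cubic_bound R y; rewrite (gtr0_norm y0) => /(_ y12).
have := ln1D_cubic_bound R (- z); rewrite normrN (gtr0_norm z0) => /(_ z12).
set Gz := _ + _ / 6; set Gy := _ + _ / 6 => bz by_.
have ay : n%:R * h * y = x by rewrite /y mulrC divfK// gt_eqF.
have cz : n%:R * (1 - h) * z = x by rewrite /z mulrC divfK// gt_eqF.
have e1 : i%:R * ln (1 + y) = n%:R * h * Gy + x + x * y / 2 - x * y ^+ 2 / 6.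
  by rewrite iE -ay /Gy; ring.
have e2 : (n - i)%:R * ln (1 - z) = n%:R * (1 - h) * Gz - x + x * z / 2 + x * z ^+ 2 / 6.
  by rewrite jE -cz /Gz; ring.
have e3 : x * y + x * z = d ^+ 2.
  have -> : x * y + x * z = x ^+ 2 / (n%:R * h * (1 - h)).
    by rewrite /y /z; field; rewrite !gt_eqF.
  by rewrite xd mulfK// !mulf_neq0// gt_eqF.
have {}by_ : `|n%:R * h * Gy| <= 2 * x * y ^+ 3.
  rewrite normrM gtr0_norm// -{1}ay.
  rewrite (_ : 2 * _ * _ = n%:R * h * (2 * y ^+ 4)) ?ler_pM2l//; ring.
have {}bz : `|n%:R * (1 - h) * Gz| <= 2 * x * z ^+ 3.
  rewrite normrM gtr0_norm// -{1}cz.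
  rewrite (_ : 2 * _ * _ = n%:R * (1 - h) * (2 * (- z) ^+ 4)) ?ler_pM2l//; ring.
rewrite e1 e2 lnI lnJ lnx.
move: by_ bz; rewrite !ler_norml => /andP[p1 p2] /andP[q1 q2] /andP[r1 r2].
by apply/andP; split; lra.
Qed.

(** * The law of an order statistic *)

(** In a sorted sequence the entries below [c] form a prefix. *)
Lemma nth_sort_lt (R : realType) (s : seq R) (i : nat) (c : R) :
  (0 < i <= size s)%N ->
  (nth 0 (sort <=%R s) i.-1 < c) = (i <= count (fun x => x < c)%R s)%N.
Proof.
case: i => // i /= i_s.
have/permP/(_ (fun x => x < c)) <- := permEl (perm_sort <=%R s).
have ss : sorted <=%R (sort <=%R s) by apply: sort_le_sorted.
have si : (i < size (sort <=%R s))%N by rewrite size_sort.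
move: (sort <=%R s) ss si => {i_s s} s ss si.
have mono := le_sorted_leq_nth 0 ss.
apply/idP/idP => [ic|].
  rewrite -(cat_take_drop i.+1 s) count_cat (@leq_trans i.+1)//.
  rewrite (_ : count _ (take i.+1 s) = i.+1) ?leq_addr//.
  rewrite -[RHS](size_takel si); apply/eqP; rewrite -all_count.
  apply/(all_nthP 0) => j; rewrite size_takel// => ji; rewrite nth_take//.
  by apply: le_lt_trans ic; apply: mono => //; rewrite inE (leq_trans ji).
apply: contraLR; rewrite -leNgt -ltnNge ltnS => ci.
rewrite -(cat_take_drop i s) count_cat.
rewrite [X in (_ + X)%N](_ : _ = 0%N); last first.
  apply/eqP; rewrite -leqn0 leqNgt -has_count -all_predC.
  apply/(all_nthP 0) => j; rewrite size_drop ltn_subRL => ji.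
  rewrite nth_drop /= -leNgt (le_trans ci)//.
  by apply: mono; rewrite ?inE// leq_addr.
by rewrite addn0 (leq_trans (count_size _ _))// size_take si.
Qed.

Lemma order_stat_lt (R : realType) n (x : 'I_n -> R) (i : nat) (c : R) :
  (0 < i <= n)%N ->
  (order_stat x i < c) = (i <= #|[set k | (x k < c)%R]%SET|)%N.
Proof.
move=> i_n; rewrite /order_stat nth_sort_lt ?size_codom ?card_ord//.
by rewrite /codom /image_mem count_map cardsE cardE enumT /enum_mem size_filter.
Qed.

Lemma uniform_prob01_lt (R : realType) (c : R) : 0 <= c <= 1 ->
  uniform_prob (@ltr01 R) [set x | x < c] = c%:E.
Proof.
move=> /andP[c0 c1]; rewrite /uniform_prob integral_uniform_pdf.
have -> : [set x | x < c] `&` `[0, 1] = `[0, c[%classic.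
  apply/seteqP; split=> x /=; rewrite !in_itv/=.
    by move=> [-> /andP[-> _]].
  by move=> /andP[x0 xc]; rewrite xc x0/= (le_trans (ltW xc) c1).
rewrite (eq_integral (fun=> 1%:E)); last first.
  move=> x; rewrite inE/= in_itv/= => /andP[x0 xc].
  by rewrite /uniform_pdf x0 (le_trans (ltW xc) c1) subr0 invr1.
rewrite integral_cst//= mul1e lebesgue_measure_itv/= lte_fin.
case: ltP; first by rewrite oppr0 adde0.
by move=> h; congr EFin; apply/le_anti/andP.
Qed.

(** The event [order_stat < c] is the disjoint union, over the sets [A] of at
    least [i] indices, of the events that [A] is exactly the set of indices whose
    variable is below [c]; independence gives the probability of each of them. *)
Section binomial_event.
Context {R : realType} {d : measure_display} {T : measurableType d}.
Context {P : probability T R} {n : nat} {X : 'I_n -> {RV P >-> R}}.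
Variable (c : R).
Hypothesis c01 : 0 <= c <= 1.
Hypothesis iidX : iid_uniform01 X.

Let pattern (A : {set 'I_n}) : set T :=
  [set w | [set k | (X k w < c)%R]%SET = A].

Let half (A : {set 'I_n}) (k : 'I_n) : set R :=
  if k \in A then [set x | x < c] else ~` [set x | x < c].

Let measurable_half A k : measurable (half A k).
Proof.
have m : measurable [set x : R | x < c].
  by rewrite [X in measurable X](_ : _ = `]-oo, c[%classic)// set_itvNyo.
by rewrite /half; case: ifPn => // _; exact: measurableC.
Qed.

Let patternE A : pattern A = [set w | forall k, half A k (X k w)].
Proof.
apply/seteqP; split=> w /=; rewrite /pattern /half /=.
  by move=> <- k; rewrite inE; case: ifPn => // /negP.
move=> h; apply/setP => k; rewrite inE.
by have := h k; case: ifPn => //= _ /negP/negbTE.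
Qed.

Let measurable_pattern A : measurable (pattern A).
Proof.
rewrite patternE.
rewrite [X in measurable X](_ : _ = \bigcap_k (X k @^-1` half A k)); last first.
  by apply/seteqP; split=> w /= h k; [move=> _|]; exact: h.
apply: fin_bigcap_measurable => // k _.
by rewrite -[X in measurable X]setTI; exact: measurable_funPT.
Qed.

Let prob_pattern A : P (pattern A) = (c ^+ #|A| * (1 - c) ^+ (n - #|A|))%:E.
Proof.
case: iidX => indep unif.
rewrite patternE indep//.
have e k : P (X k @^-1` half A k) = (if k \in A then c else 1 - c)%:E.
  rewrite (_ : P _ = distribution P (X k) (half A k))// unif//.
  rewrite /half; case: ifPn => _; first exact: uniform_prob01_lt.
  rewrite probability_setC; last first.
    by rewrite [X in measurable X](_ : _ = `]-oo, c[%classic)// set_itvNyo.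
  by rewrite EFinB; congr (1 - _)%E; exact: uniform_prob01_lt.
under eq_bigr do rewrite e.
rewrite prodEFin; congr EFin.
rewrite (bigID (mem A))/=.
rewrite (eq_bigr (fun=> c)); last by move=> k ->.
rewrite [X in _ * X](eq_bigr (fun=> 1 - c)); last by move=> k /negbTE ->.
rewrite !prodr_const; congr (_ * _ ^+ _).
rewrite -[X in (X - _)%N](card_ord n) -(cardC (mem A)) addKn.
by apply: eq_card => k; rewrite !inE.
Qed.

Lemma prob_order_stat_lt (i : nat) : (0 < i <= n)%N ->
  P [set w | order_stat (fun k => X k w) i < c] = (binom_tail R n c i)%:E.
Proof.
move=> i_n.
pose D := enum [pred A : {set 'I_n} | (i <= #|A|)%N].
rewrite [X in P X](_ : _ = \bigcup_(A in [set` D]) pattern A); last first.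
  apply/seteqP; split=> w /=; rewrite order_stat_lt//.
    by move=> iw; eexists; last reflexivity; rewrite /= mem_enum.
  by move=> [A/=]; rewrite mem_enum => iA; rewrite /pattern/= => ->.
rewrite measure_fin_bigcup//; last first.
  by move=> A B _ _ [w [/= <- <-]].
rewrite -fsbig_seq ?enum_uniq//= big_enum/=.
under eq_bigr do rewrite prob_pattern.
rewrite sumEFin; congr EFin.
pose f k : R := c ^+ k * (1 - c) ^+ (n - k).
rewrite /binom_tail big_geq_mkord.
have cn (A : {set 'I_n}) : (#|A| < n.+1)%N.
  by rewrite ltnS -[leqRHS](card_ord n) max_card.
rewrite (partition_big (fun A : {set 'I_n} => Ordinal (cn A))
  (fun k : 'I_n.+1 => (i <= k)%N))//=.
apply: eq_bigr => k ik.
rewrite (eq_bigr (fun=> f k)); last first.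
  by move=> A /andP[_ /eqP <-].
rewrite sumr_const /binom_mass -/(f k) mulr_natl; congr (_ *+ _).
rewrite -[n in 'C(n, _)]card_ord -card_draws cardsE.
apply: eq_card => A; rewrite -!topredE/= -val_eqE/=.
by apply: andb_idl; rewrite inE => /eqP ->.
Qed.

End binomial_event.

(** * Limits of real sequences *)

Lemma cvg_eq_near (R : realType) (f g : nat -> R) (l : R) :
  (\forall n \near \oo, g n = f n) -> f n @[n --> \oo] --> l ->
  g n @[n --> \oo] --> l.
Proof.
move=> fg; apply: cvg_trans; apply: near_eq_cvg.
by apply: filterS fg.
Qed.

Lemma cvg0_le_near (R : realType) (f g : nat -> R) :
  (\forall n \near \oo, `|f n| <= g n) -> g n @[n --> \oo] --> 0 ->
  f n @[n --> \oo] --> 0.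
Proof.
move=> fg g0; apply/norm_cvg0P; apply: (squeeze_cvgr _ (cvg_cst 0) g0).
by apply: filterS fg => n h; apply/andP; split; [exact: normr_ge0|exact: h].
Qed.

Lemma cvg_invy0 (R : realType) (f : nat -> R) :
  f n @[n --> \oo] --> +oo -> (f n)^-1 @[n --> \oo] --> 0.
Proof.
move=> fy; have f0 : \forall n \near \oo, 0 < f n by exact: cvgry_gt.
exact: (gtr0_cvgV0 f0).2.
Qed.

Lemma cvg_sqrt (R : realType) (f : nat -> R) (l : R) :
  f n @[n --> \oo] --> l -> Num.sqrt (f n) @[n --> \oo] --> Num.sqrt l.
Proof. by move=> fl; apply: continuous_cvg fl; exact: sqrt_continuous. Qed.

Lemma cvg_ln (R : realType) (f : nat -> R) (l : R) : 0 < l ->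
  f n @[n --> \oo] --> l -> ln (f n) @[n --> \oo] --> ln l.
Proof. by move=> l0 fl; apply: continuous_cvg fl; exact: continuous_ln. Qed.

Lemma cvgn_mul (R : realType) (f g : nat -> R) (a b : R) :
  f n @[n --> \oo] --> a -> g n @[n --> \oo] --> b ->
  f n * g n @[n --> \oo] --> a * b.
Proof. exact: cvgM. Qed.

Lemma cvgn_inv (R : realType) (f : nat -> R) (a : R) : a != 0 ->
  f n @[n --> \oo] --> a -> (f n)^-1 @[n --> \oo] --> a^-1.
Proof. exact: cvgV. Qed.

Lemma cvgn_exp (R : realType) (f : nat -> R) (a : R) k :
  f n @[n --> \oo] --> a -> f n ^+ k @[n --> \oo] --> a ^+ k.
Proof.
move=> fa; elim: k => [|k IH]; first by rewrite expr0; exact: cvg_cst.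
rewrite exprS; apply: cvg_eq_near (cvgn_mul _ _ _ _ _ fa IH).
by apply: nearW => n; rewrite exprS.
Qed.

Lemma cvgny_mul (R : realType) (f : nat -> R) (k : R) : 0 < k ->
  f n @[n --> \oo] --> +oo -> f n * k @[n --> \oo] --> +oo.
Proof.
move=> k0 fy; apply/cvgryPge => A; near=> n.
by rewrite -ler_pdivrMr//; near: n; exact: cvgry_ge.
Unshelve. all: by end_near. Qed.

(** * The critical values *)

(** The equation is quadratic in [h] and [hc_crit] is its smaller root. *)
Lemma hc_crit_root (R : realType) n i (d : R) : 0 < d -> (0 < i < n)%N ->
  let h := hc_crit n i d in
  [/\ 0 < h < 1, n%:R * h < i%:R &
    (i%:R - n%:R * h) ^+ 2 = d ^+ 2 * (n%:R * h * (1 - h))].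
Proof.
move=> d0 /andP[i0 i_n] h.
have I0 : 0 < i%:R :> R by rewrite ltr0n.
have N0 : 0 < n%:R :> R by rewrite ltr0n (leq_trans i0)// ltnW.
have IN : i%:R < n%:R :> R by rewrite ltr_nat.
have : h = hc_crit n i d by [].
clearbody h; rewrite /hc_crit.
move: (i%:R) (n%:R) I0 N0 IN => I N I0 N0 IN.
set D := d ^+ 2 + 4 * I - 4 * I ^+ 2 / N.
have DE : D = d ^+ 2 + 4 * I * (N - I) / N by rewrite /D; field; rewrite gt_eqF.
have d2 : 0 < d ^+ 2 by rewrite exprn_gt0.
have dD : d ^+ 2 < D by rewrite DE ltrDl divr_gt0// mulr_gt0 ?subr_gt0// mulr_gt0.
have D0 : 0 <= D by rewrite ltW// (lt_trans d2).
set s := Num.sqrt D.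
have s2 : s ^+ 2 = D by rewrite sqr_sqrtr.
have ds : d < s.
  by rewrite -(@ltr_pXn2r _ 2) ?nnegrE ?sqrtr_ge0 ?(ltW d0)// s2.
have A0 : 0 < 2 * (d ^+ 2 + N) by rewrite mulr_gt0// addr_gt0.
move=> hdef.
have hE : h * (2 * (d ^+ 2 + N)) = d ^+ 2 + 2 * I - d * s.
  by rewrite hdef divfK// gt_eqF.
have h0 : 0 < h.
  rewrite hdef divr_gt0// subr_gt0.
  rewrite -(@ltr_pXn2r _ 2) ?nnegrE//; last 2 first.
  - by rewrite mulr_ge0 ?sqrtr_ge0// ltW.
  - by rewrite addr_ge0 ?mulr_ge0 ?(ltW I0)// ltW.
  rewrite exprMn s2 /D -subr_gt0.
  have -> : (d ^+ 2 + 2 * I) ^+ 2 - d ^+ 2 * (d ^+ 2 + 4 * I - 4 * I ^+ 2 / N) =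
    4 * I ^+ 2 * (1 + d ^+ 2 / N) by field; rewrite gt_eqF.
  by rewrite !mulr_gt0 ?exprn_gt0// addr_gt0// divr_gt0.
have hI : N * h < I.
  rewrite -(ltr_pM2r A0) -mulrA hE.
  have := mulr_gt0 I0 d2; have : N * d * (s - d) > 0.
    by rewrite !mulr_gt0// subr_gt0.
  rewrite !expr2; nra.
have h1 : h < 1.
  by rewrite -(ltr_pM2l N0) mulr1 (lt_trans hI).
split=> //; first by rewrite h0.
have : (d * s) ^+ 2 = d ^+ 2 * (d ^+ 2 + 4 * I - 4 * I ^+ 2 / N) by rewrite exprMn s2.
have -> : d * s = d ^+ 2 + 2 * I - h * (2 * (d ^+ 2 + N)) by rewrite hE; ring.
move/eqP; rewrite -subr_eq0.
have -> : (d ^+ 2 + 2 * I - h * (2 * (d ^+ 2 + N))) ^+ 2 -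
  d ^+ 2 * (d ^+ 2 + 4 * I - 4 * I ^+ 2 / N) =
  4 * (d ^+ 2 + N) / N * ((I - N * h) ^+ 2 - d ^+ 2 * (N * h * (1 - h))).
  by field; rewrite gt_eqF.
rewrite mulf_eq0 gt_eqF ?divr_gt0 ?mulr_gt0 ?addr_gt0//=.
by rewrite subr_eq0 => /eqP.
Qed.

(** Any exponent below [1 / 2] serves to bound [ln u ^+ 2] by something
    negligible against [u]; the exponent [1 / 4] only takes square roots. *)
Lemma ln_le_root4 (R : realType) (v : R) : 0 < v ->
  ln v <= 4 * Num.sqrt (Num.sqrt v).
Proof.
move=> v0; set r := Num.sqrt (Num.sqrt v).
have r0 : 0 < r by rewrite !sqrtr_gt0.
have -> : v = r ^+ 4.
  by rewrite (exprM r 2 2) !sqr_sqrtr ?sqrtr_ge0// ltW.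
rewrite lnXn// -[ln r *+ 4]mulr_natl ler_pM2l//.
by rewrite ltW// ln_sublinear.
Qed.

Lemma ln_sqr_over_cvg0 (R : realType) (u : nat -> R) :
  u n @[n --> \oo] --> +oo -> ln (u n) ^+ 2 / u n @[n --> \oo] --> 0.
Proof.
move=> uy.
apply: (@cvg0_le_near _ _ (fun n => 16 * Num.sqrt (u n)^-1)).
  near=> n.
  have u1 : 1 <= u n by near: n; exact: cvgry_ge.
  have u0 : 0 < u n by lra.
  rewrite ger0_norm; last by rewrite divr_ge0 ?sqr_ge0// ltW.
  rewrite ler_pdivrMr// sqrtrV ?(ltW u0)//.
  have -> : 16 * (Num.sqrt (u n))^-1 * u n = (4 * Num.sqrt (Num.sqrt (u n))) ^+ 2.
    rewrite exprMn sqr_sqrtr ?sqrtr_ge0//.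
    have := sqr_sqrtr (ltW u0); have : 0 < Num.sqrt (u n) by rewrite sqrtr_gt0.
    by move: (Num.sqrt (u n)) => r r0 <-; field; rewrite gt_eqF.
  rewrite ler_sqr ?nnegrE ?ln_ge0// ?mulr_ge0// ?sqrtr_ge0//.
  exact: ln_le_root4.
rewrite -[X in _ --> X](mulr0 16) -[X in _ * X](@sqrtr0 R).
by apply: cvgMl_tmp; apply: cvg_sqrt; exact: cvg_invy0.
Unshelve. all: by end_near. Qed.

Lemma loglog_cvgy (R : realType) : loglog R n @[n --> \oo] --> +oo.
Proof.
apply/cvgryPge => A; near=> n.
have n1 : expR (expR A) <= n%:R by near: n; exact: nbhs_infty_ger.
have n0 : 0 < n%:R :> R by apply: lt_le_trans n1; exact: expR_gt0.
have L1 : expR A <= ln n%:R by rewrite -[leLHS]expRK ler_ln ?posrE ?expR_gt0.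
have L0 : 0 < ln n%:R :> R by apply: lt_le_trans L1; exact: expR_gt0.
by rewrite /loglog -[leLHS](expRK A) ler_ln ?posrE ?expR_gt0.
Unshelve. all: by end_near. Qed.

Lemma loglog_expR (R : realType) :
  \forall n \near \oo, expR (loglog R n) = ln n%:R /\ expR (ln n%:R) = n%:R :> R.
Proof.
near=> n.
have n1 : expR 1 <= n%:R :> R by near: n; exact: nbhs_infty_ger.
have n0 : 0 < n%:R :> R by apply: lt_le_trans n1; exact: expR_gt0.
have L1 : 1 <= ln n%:R :> R by rewrite -[leLHS](expRK 1) ler_ln ?posrE ?expR_gt0.
have L0 : 0 < ln n%:R :> R by lra.
by rewrite /loglog !lnK.
Unshelve. all: by end_near. Qed.

(** Each exponential dominates a power: [ln n >= (u / 3) ^+ 3] and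
    [n >= (ln n / 2) ^+ 2]. *)
Lemma loglog3_over_cvg0 (R : realType) :
  loglog R n ^+ 3 / n%:R @[n --> \oo] --> (0 : R).
Proof.
apply: (@cvg0_le_near _ _ (fun n => 108 * (loglog R n)^-1)); last first.
  rewrite -[X in _ --> X](mulr0 108); apply: cvgMl_tmp; apply: cvg_invy0.
  exact: loglog_cvgy.
near=> n.
have uLE : expR (loglog R n) = ln n%:R /\ expR (ln n%:R) = n%:R :> R.
  by near: n; exact: loglog_expR.
case: uLE => uE LE.
have u1 : 1 <= loglog R n.
  by near: n; apply: (cvgry_ge (loglog_cvgy R)).
move: (loglog R n) (ln n%:R) uE LE u1 => u L uE LE u1.
have u0 : 0 < u by lra.
have L0 : 0 < L by rewrite -uE expR_gt0.
have h1 : (u / 3) ^+ 3 <= L.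
  rewrite -uE (_ : expR u = expR (u / 3) ^+ 3); last by rewrite -expRM_natr divfK.
  rewrite lerXn2r ?nnegrE ?expR_ge0 ?divr_ge0 ?(ltW u0)//.
  by have := expR_ge1Dx (u / 3); lra.
have h2 : (L / 2) ^+ 2 <= n%:R.
  rewrite -LE (_ : expR L = expR (L / 2) ^+ 2); last by rewrite -expRM_natr divfK.
  rewrite lerXn2r ?nnegrE ?expR_ge0 ?divr_ge0 ?(ltW L0)//.
  by have := expR_ge1Dx (L / 2); lra.
have h3 : u <= L by rewrite -uE; have := expR_ge1Dx u; lra.
have n0 : 0 < n%:R :> R by rewrite -LE expR_gt0.
rewrite ger0_norm ?divr_ge0 ?exprn_ge0 ?(ltW n0) ?(ltW u0)// ler_pdivrMr//.
rewrite -(ler_pM2r u0) [leRHS]mulrAC divfK ?gt_eqF//.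
(* [n] exceeds [L ^+ 2 / 4] and [u ^+ 3] is at most [27 * L], so the quotient is
   at most [108 / L], and [u <= L]. *)
have h4 : u ^+ 3 <= 27 * L.
  by rewrite (_ : u ^+ 3 = 27 * (u / 3) ^+ 3); [rewrite ler_pM2l|field].
apply: (@le_trans _ _ (27 * L * L)).
  by rewrite ler_pM// ?exprn_ge0 ?(ltW u0)//.
have -> : 27 * L * L = 108 * (L / 2) ^+ 2 by field.
by rewrite ler_pM2l.
Unshelve. all: by end_near. Qed.

(** With [u := loglog R n], the level is [(2 * u + hc_shift) / sqrt (2 * u)]. *)
Definition hc_shift (R : realType) (t : R) (n : nat) : R :=
  t + (ln (loglog R n) - ln pi) / 2.

(** The shift is of the order of [ln u]. *)
Lemma hc_shift_sqr_cvg0 (R : realType) (t : R) :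
  hc_shift R t n ^+ 2 / loglog R n @[n --> \oo] --> 0.
Proof.
pose c := t - ln pi / 2.
have uy := loglog_cvgy R.
have v0 := cvg_invy0 _ _ uy.
apply: (@cvg0_le_near _ _ (fun n => 2 * c ^+ 2 * (loglog R n)^-1 +
    2^-1 * (ln (loglog R n) ^+ 2 / loglog R n))).
  near=> n.
  have u0 : 0 < loglog R n by near: n; exact: cvgry_gt.
  rewrite ger0_norm ?divr_ge0 ?sqr_ge0 ?(ltW u0)//.
  rewrite [X in _ <= _ + X]mulrA -[leRHS]mulrDl ler_pM2r ?invr_gt0//.
  rewrite /hc_shift /c; move: (ln (loglog R n)) (ln pi) => v w.
  rewrite -subr_ge0.
  have -> : 2 * (t - w / 2) ^+ 2 + 2^-1 * v ^+ 2 - (t + (v - w) / 2) ^+ 2 =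
    (t - w / 2 - v / 2) ^+ 2 by field.
  exact: sqr_ge0.
have -> : 0 = 2 * c ^+ 2 * 0 + 2^-1 * 0 :> R by rewrite !mulr0 addr0.
by apply: cvgD; apply: cvgMl_tmp => //; exact: ln_sqr_over_cvg0.
Unshelve. all: by end_near. Qed.

Lemma hc_shift_cvg0 (R : realType) (t : R) :
  hc_shift R t n / loglog R n @[n --> \oo] --> 0.
Proof.
have uy := loglog_cvgy R.
have h := cvg_sqrt _ _ _ (hc_shift_sqr_cvg0 R t).
rewrite sqrtr0 in h.
apply: cvg0_le_near h; near=> n.
have u1 : 1 <= loglog R n by near: n; exact: cvgry_ge.
have u0 : 0 < loglog R n by lra.
rewrite -sqrtr_sqr ler_sqrt ?divr_ge0 ?sqr_ge0 ?(ltW u0)//.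
rewrite exprMn ler_wpM2l ?sqr_ge0// exprVn lef_pV2 ?posrE ?exprn_gt0//.
by rewrite expr2 ler_peMl// ltW.
Unshelve. all: by end_near. Qed.

Lemma hc_level_sqr (R : realType) (t : R) n : let u := loglog R n in
  let s := hc_shift R t n in 0 < u ->
  hc_level t n ^+ 2 / (2 * u) = (1 + (s / u) / 2) ^+ 2.
Proof.
move=> u s u0; rewrite /hc_level -/u.
rewrite (_ : t + 2 * u + _ = 2 * u + s); last by rewrite /s /hc_shift -/u; ring.
rewrite exprMn exprVn sqr_sqrtr; last by rewrite mulr_ge0// ltW.
by field; rewrite gt_eqF.
Qed.

Lemma hc_level_sqr_cvg (R : realType) (t : R) :
  hc_level t n ^+ 2 / (2 * loglog R n) @[n --> \oo] --> (1 : R).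
Proof.
have uy := loglog_cvgy R.
have h := hc_shift_cvg0 R t.
apply: (@cvg_eq_near _ (fun n => (1 + (hc_shift R t n / loglog R n) / 2) ^+ 2)).
  near=> n; have u0 : 0 < loglog R n by near: n; exact: cvgry_gt.
  exact: hc_level_sqr.
have h1 : 1 + (hc_shift R t n / loglog R n) / 2 @[n --> \oo] --> (1 : R).
  rewrite -[X in _ --> X]addr0; apply: cvgD; first exact: cvg_cst.
  by rewrite -[X in _ --> X](mul0r 2^-1); apply: cvgMr_tmp.
have : (1 + (hc_shift R t n / loglog R n) / 2) * (1 + (hc_shift R t n / loglog R n) / 2)
    @[n --> \oo] --> (1 : R) * 1 by exact: cvgM.
rewrite mulr1; apply: cvg_eq_near; apply: nearW => n; exact: expr2.
Unshelve. all: by end_near. Qed.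

Lemma hc_level_gt0 (R : realType) (t : R) : \forall n \near \oo, 0 < hc_level t n.
Proof.
have uy := loglog_cvgy R.
have h := hc_shift_cvg0 R t.
near=> n; have u0 : 0 < loglog R n by near: n; exact: cvgry_gt.
rewrite /hc_level divr_gt0 ?sqrtr_gt0 ?mulr_gt0//.
rewrite (_ : t + 2 * _ + _ = (2 + hc_shift R t n / loglog R n) * loglog R n); last first.
  by rewrite [RHS]mulrDl divfK ?gt_eqF// /hc_shift; ring.
rewrite mulr_gt0//.
have : `|hc_shift R t n / loglog R n| < 1.
  by near: n; move/cvgr0Pnorm_lt : h; exact.
rewrite ltr_norml => /andP[]; lra.
Unshelve. all: by end_near. Qed.

(** The level is calibrated on the tail [exp (- d ^+ 2 / 2) / (sqrt (2 * pi) * d)]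
    of the normal law: with [s := hc_shift R t n] and [u := loglog R n], the
    difference is exactly [- ln (1 + s / (2 * u)) - s ^+ 2 / (4 * u)]. *)
Lemma hc_level_gaussian_tail (R : realType) (t : R) :
  (- ln (hc_level t n) - hc_level t n ^+ 2 / 2 - ln (2 * pi) / 2) -
  ln (expR (- t) / (2 * loglog R n * ln n%:R)) @[n --> \oo] --> 0.
Proof.
have uy := loglog_cvgy R.
have h := hc_shift_cvg0 R t.
have h2 := hc_shift_sqr_cvg0 R t.
apply: (@cvg_eq_near _ (fun n => - ln (1 + (hc_shift R t n / loglog R n) / 2)
   - (hc_shift R t n ^+ 2 / loglog R n) / 4)); last first.
  rewrite -[X in _ --> X]subr0; apply: cvgB; last first.
    by rewrite -[X in _ --> X](mul0r 4^-1); apply: cvgMr_tmp.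
  rewrite -[X in _ --> X]oppr0; apply: cvgN; rewrite -(@ln1 R).
  apply: cvg_ln => //.
  rewrite -[X in _ --> X]addr0; apply: cvgD; first exact: cvg_cst.
  by rewrite -[X in _ --> X](mul0r 2^-1); apply: cvgMr_tmp.
near=> n; have u0 : 0 < loglog R n by near: n; exact: cvgry_gt.
have uLE : expR (loglog R n) = ln n%:R /\ expR (ln n%:R) = n%:R :> R.
  by near: n; exact: loglog_expR.
case: uLE => uE LE.
have d0 : 0 < hc_level t n by near: n; exact: hc_level_gt0.
have dE := hc_level_sqr R t n u0.
have s1 : 0 < 1 + hc_shift R t n / loglog R n / 2.
  have : `|hc_shift R t n / loglog R n| < 1.
    by near: n; move/cvgr0Pnorm_lt : h; exact.
  rewrite ltr_norml => /andP[]; lra.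
have d2 : hc_level t n ^+ 2 / 2 = loglog R n * (1 + hc_shift R t n / loglog R n / 2) ^+ 2.
  by rewrite -dE; field; rewrite gt_eqF.
have lnd : ln (hc_level t n) = (ln 2 + ln (loglog R n)) / 2
    + ln (1 + hc_shift R t n / loglog R n / 2).
  have : ln (hc_level t n ^+ 2) =
      ln (2 * loglog R n * (1 + hc_shift R t n / loglog R n / 2) ^+ 2).
    by congr ln; rewrite -dE; field; rewrite gt_eqF.
  rewrite lnXn// lnM ?posrE ?mulr_gt0 ?exprn_gt0// lnXn// lnM ?posrE//.
  rewrite -[ln (hc_level t n) *+ 2]mulr_natl -[ln (1 + _) *+ 2]mulr_natl; lra.
rewrite d2 lnd ln_div ?posrE ?mulr_gt0 ?expR_gt0//; last by rewrite -uE expR_gt0.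
rewrite !lnM ?posrE ?mulr_gt0 ?pi_gt0//; last by rewrite -uE expR_gt0.
rewrite expRK -uE expRK.
have : (loglog R n * (1 + hc_shift R t n / loglog R n / 2) ^+ 2) =
  loglog R n + hc_shift R t n + hc_shift R t n ^+ 2 / loglog R n / 4.
  by field; rewrite gt_eqF.
move=> ->.
rewrite [X in _ - (_ + X + _) - _ / 2 - _]/hc_shift.
move: (ln (1 + _)) (hc_shift R t n ^+ 2 / _ / 4) => v w.
by field.
Unshelve. all: by end_near. Qed.

(** * The skewness correction *)

(** Here [m] is the rank counted from its own end of the sample, [p] and [q] are
    the expected numbers of points on the side of [m] and on the other side, and
    [x] is the distance from [p] to [m], namely [d] standard deviations.  The two
    sides play the same role in all these relations, which is why both cases of
    the theorem reduce to this setting. *)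
Section skewness.
Context {R : realType} (u m p q x d N : nat -> R).
Hypothesis near_pos : \forall n \near \oo,
  [/\ 0 < u n, 0 < m n, 0 < p n, 0 < q n & 0 < x n].
Hypothesis near_rel : \forall n \near \oo,
  [/\ p n + q n = N n, `|p n - m n| = x n &
   x n ^+ 2 = d n ^+ 2 * (p n * q n / N n)].
Hypothesis cvg_d : d n ^+ 2 / (2 * u n) @[n --> \oo] --> (1 : R).
Hypothesis cvg_m : m n / u n @[n --> \oo] --> +oo.
Hypothesis cvg_mN : m n / N n @[n --> \oo] --> (0 : R).

Let T n := Num.sqrt 2 / 3 * (u n * Num.sqrt (u n / m n)).

(** With [w := x / m] and [eps := d ^+ 2 / m], which tends to [0], the relations
    give [w ^+ 2 <= eps * (1 + w)], hence [w ^+ 2 <= 2 * eps + eps ^+ 2]. *)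
Let cvg_x_m : x n / m n @[n --> \oo] --> (0 : R).
Proof.
have um : u n / m n @[n --> \oo] --> (0 : R).
  apply: cvg_eq_near (cvg_invy0 _ _ cvg_m).
  by apply: nearW => n; rewrite invf_div.
pose eps n := d n ^+ 2 / (2 * u n) * (2 * (u n / m n)).
have e0 : eps n @[n --> \oo] --> (0 : R).
  rewrite -[X in _ --> X](mulr0 1); apply: cvgM => //.
  by rewrite -[X in _ --> X](mulr0 2); apply: cvgMl_tmp.
have : Num.sqrt (2 * eps n + eps n * eps n) @[n --> \oo] --> (0 : R).
  rewrite -[X in _ --> X]sqrtr0; apply: cvg_sqrt.
  have -> : (0 : R) = 2 * 0 + 0 * 0 by rewrite !mulr0 addr0.
  by apply: cvgD; [exact: cvgMl_tmp|exact: cvgM].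
apply: cvg0_le_near; near=> n.
have : [/\ 0 < u n, 0 < m n, 0 < p n, 0 < q n & 0 < x n] by near: n.
case=> u0 m0 p0 q0 x0.
have : [/\ p n + q n = N n, `|p n - m n| = x n &
   x n ^+ 2 = d n ^+ 2 * (p n * q n / N n)] by near: n.
case=> pq pm xd.
have N0 : 0 < N n by rewrite -pq addr_gt0.
have epsE : eps n = d n ^+ 2 / m n by rewrite /eps; field; rewrite !gt_eqF.
have eps0 : 0 <= eps n by rewrite epsE divr_ge0 ?sqr_ge0// ltW.
have w0 : 0 <= x n / m n by rewrite divr_ge0 ?ltW.
have pmx : p n <= m n + x n by rewrite -pm -lerBlDl ler_norm.
have qN : q n / N n <= 1 by rewrite ler_pdivrMr// mul1r -pq lerDr ltW.
have w2 : (x n / m n) ^+ 2 <= eps n * (1 + x n / m n).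
  rewrite expr_div_n xd.
  apply: (@le_trans _ _ (d n ^+ 2 * (m n + x n) / m n ^+ 2)).
    rewrite ler_pM2r ?invr_gt0 ?exprn_gt0// ler_wpM2l ?sqr_ge0//.
    rewrite -mulrA -[leRHS]mulr1 ler_pM ?divr_ge0 ?(ltW p0) ?(ltW q0) ?(ltW N0)//.
  by rewrite le_eqVlt; apply/orP; left; apply/eqP; rewrite epsE; field; rewrite gt_eqF.
rewrite ger0_norm// -[leLHS]ger0_norm// -sqrtr_sqr ler_wsqrtr//.
move: (x n / m n) (eps n) w0 eps0 w2 => w e w0 eps0 w2; nra.
Unshelve. all: by end_near. Qed.

Let cvg_p_m : p n / m n @[n --> \oo] --> (1 : R).
Proof.
have h : (p n / m n - 1) @[n --> \oo] --> (0 : R).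
  apply: cvg0_le_near cvg_x_m; near=> n.
  have : [/\ 0 < u n, 0 < m n, 0 < p n, 0 < q n & 0 < x n] by near: n.
  case=> u0 m0 p0 q0 x0.
  have : [/\ p n + q n = N n, `|p n - m n| = x n &
     x n ^+ 2 = d n ^+ 2 * (p n * q n / N n)] by near: n.
  case=> pq pm xd.
  rewrite -pm -[X in _ <= _ / X](gtr0_norm m0) -normf_div.
  by rewrite mulrBl divff ?gt_eqF.
have : (p n / m n - 1) + 1 @[n --> \oo] --> (0 + 1 : R).
  by apply: cvgD => //; exact: cvg_cst.
by rewrite add0r; apply: cvg_eq_near; apply: nearW => n; rewrite subrK.
Unshelve. all: by end_near. Qed.

Let cvg_m_p : m n / p n @[n --> \oo] --> (1 : R).
Proof.
have := cvgn_inv _ _ _ (oner_neq0 R) cvg_p_m; rewrite invr1.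
by apply: cvg_eq_near; apply: nearW => n; rewrite invf_div.
Qed.

Let cvg_p_N : p n / N n @[n --> \oo] --> (0 : R).
Proof.
have := cvgn_mul _ _ _ _ _ cvg_p_m cvg_mN; rewrite mul1r; apply: cvg_eq_near.
near=> n.
have : [/\ 0 < u n, 0 < m n, 0 < p n, 0 < q n & 0 < x n] by near: n.
by case=> u0 m0 p0 q0 x0 /=; rewrite mulrA divfK ?gt_eqF.
Unshelve. all: by end_near. Qed.

Let cvg_q_N : q n / N n @[n --> \oo] --> (1 : R).
Proof.
have : 1 - p n / N n @[n --> \oo] --> (1 - 0 : R).
  by apply: cvgB => //; exact: cvg_cst.
rewrite subr0; apply: cvg_eq_near; near=> n.
have : [/\ 0 < u n, 0 < m n, 0 < p n, 0 < q n & 0 < x n] by near: n.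
case=> u0 m0 p0 q0 x0.
have : [/\ p n + q n = N n, `|p n - m n| = x n &
   x n ^+ 2 = d n ^+ 2 * (p n * q n / N n)] by near: n.
case=> pq pm xd; rewrite -pq; field; rewrite gt_eqF// addr_gt0//.
Unshelve. all: by end_near. Qed.

Let cvg_p_q : p n / q n @[n --> \oo] --> (0 : R).
Proof.
have h := cvgn_inv _ _ _ (oner_neq0 R) cvg_q_N; rewrite invr1 in h.
have := cvgn_mul _ _ _ _ _ cvg_p_N h; rewrite mul0r; apply: cvg_eq_near; near=> n.
have : [/\ 0 < u n, 0 < m n, 0 < p n, 0 < q n & 0 < x n] by near: n.
case=> u0 m0 p0 q0 x0.
have : [/\ p n + q n = N n, `|p n - m n| = x n &
   x n ^+ 2 = d n ^+ 2 * (p n * q n / N n)] by near: n.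
case=> pq pm xd /=; rewrite -pq; field; rewrite !gt_eqF// addr_gt0//.
Unshelve. all: by end_near. Qed.

Lemma cvg_small_ratio : x n / p n @[n --> \oo] --> (0 : R).
Proof.
have := cvgn_mul _ _ _ _ _ cvg_x_m cvg_m_p; rewrite mul0r; apply: cvg_eq_near.
near=> n.
have : [/\ 0 < u n, 0 < m n, 0 < p n, 0 < q n & 0 < x n] by near: n.
by case=> u0 m0 p0 q0 x0 /=; field; rewrite !gt_eqF.
Unshelve. all: by end_near. Qed.

Lemma cvg_large_ratio : x n / q n @[n --> \oo] --> (0 : R).
Proof.
have := cvgn_mul _ _ _ _ _ cvg_small_ratio cvg_p_q; rewrite mul0r; apply: cvg_eq_near.
near=> n.
have : [/\ 0 < u n, 0 < m n, 0 < p n, 0 < q n & 0 < x n] by near: n.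
by case=> u0 m0 p0 q0 x0 /=; field; rewrite !gt_eqF.
Unshelve. all: by end_near. Qed.

(** The square of this ratio is
    [(d ^+ 2 / (2 * u)) ^+ 3 * (q / N) ^+ 3 * (m / p)], a product of quantities
    that tend to [1]. *)
Lemma cvg_skew_small :
  x n * (x n / p n) ^+ 2 / 6 / T n @[n --> \oo] --> (1 : R).
Proof.
have h : ((d n ^+ 2 / (2 * u n)) ^+ 3 * (q n / N n) ^+ 3 * (m n / p n))
    @[n --> \oo] --> (1 ^+ 3 * 1 ^+ 3 * 1 : R).
  apply: cvgM => //; apply: cvgM.
    exact: cvgn_exp.
  exact: cvgn_exp.
have := cvg_sqrt _ _ _ h; rewrite !expr1n !mulr1 sqrtr1; apply: cvg_eq_near.
near=> n.
have : [/\ 0 < u n, 0 < m n, 0 < p n, 0 < q n & 0 < x n] by near: n.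
case=> u0 m0 p0 q0 x0.
have : [/\ p n + q n = N n, `|p n - m n| = x n &
   x n ^+ 2 = d n ^+ 2 * (p n * q n / N n)] by near: n.
case=> pq pm xd.
have N0 : 0 < N n by rewrite -pq addr_gt0.
have um0 : 0 < u n / m n by rewrite divr_gt0.
have T0 : 0 < T n by rewrite /T !mulr_gt0 ?invr_gt0 ?sqrtr_gt0.
have T2 : T n ^+ 2 = 2 / 9 * u n ^+ 3 / m n.
  rewrite /T !exprMn !sqr_sqrtr ?(ltW um0)//; field; rewrite gt_eqF//.
have A0 : 0 <= x n * (x n / p n) ^+ 2 / 6 / T n.
  by rewrite !mulr_ge0 ?invr_ge0 ?exprn_ge0 ?divr_ge0 ?ltW.
rewrite -[LHS]ger0_norm// -sqrtr_sqr; congr Num.sqrt.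
transitivity ((x n ^+ 2) ^+ 3 / p n ^+ 4 / 36 / T n ^+ 2).
  by field; rewrite !gt_eqF.
by rewrite xd T2; field; rewrite !gt_eqF.
Unshelve. all: by end_near. Qed.

(** The quotient by the ratio of [cvg_skew_small] is [(p / q) ^+ 2]. *)
Lemma cvg_skew_large :
  x n * (x n / q n) ^+ 2 / 6 / T n @[n --> \oo] --> (0 : R).
Proof.
have := cvgn_mul _ _ _ _ _ cvg_skew_small (cvgn_mul _ _ _ _ _ cvg_p_q cvg_p_q).
rewrite mulr0 mul1r; apply: cvg_eq_near; near=> n.
have : [/\ 0 < u n, 0 < m n, 0 < p n, 0 < q n & 0 < x n] by near: n.
case=> u0 m0 p0 q0 x0 /=.
by move: (T n)^-1 => Ti; field; rewrite !gt_eqF.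
Unshelve. all: by end_near. Qed.

Lemma cvg_skew_rem :
  x n * ((x n / p n) ^+ 3 + (x n / q n) ^+ 3) / T n @[n --> \oo] --> (0 : R).
Proof.
have : 6 * (x n * (x n / p n) ^+ 2 / 6 / T n * (x n / p n) +
  x n * (x n / q n) ^+ 2 / 6 / T n * (x n / q n)) @[n --> \oo]
  --> (6 * (1 * 0 + 0 * 0) : R).
  apply: cvgMl_tmp; apply: cvgD.
    exact: cvgM cvg_skew_small cvg_small_ratio.
  exact: cvgM cvg_skew_large cvg_large_ratio.
rewrite !mulr0 addr0 mulr0; apply: cvg_eq_near; apply: nearW => n.
by move: (T n)^-1 (p n)^-1 (q n)^-1 => Ti pi qi; field.
Qed.

End skewness.

(** * The local levels *)

(** If [k / loglog ^+ 3] tends to [c > 0], then [k / loglog] grows like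
    [c * loglog ^+ 2]. *)
Lemma loglog_growthP (R : realType) (k : nat -> nat) : loglog_growth R k ->
  (k n)%:R / loglog R n @[n --> \oo] --> +oo /\
  exists2 C : R, 0 < C & \forall n \near \oo, (k n)%:R <= C * loglog R n ^+ 3.
Proof.
have uy := loglog_cvgy R.
have bnd (c : R) : 0 <= c -> (k n)%:R / loglog R n ^+ 3 @[n --> \oo] --> c ->
    exists2 C : R, 0 < C & \forall n \near \oo, (k n)%:R <= C * loglog R n ^+ 3.
  move=> c0 kc; exists (c + 1); first by rewrite ltr_wpDl.
  near=> n; have u0 : 0 < loglog R n by near: n; exact: cvgry_gt.
  rewrite -ler_pdivrMr ?exprn_gt0//.
  by near: n; apply: (cvgr_le _ kc); rewrite ltrDl.
move=> [[ky k0]|[c c0 kc]]; first by split => //; exact: bnd k0.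
split; last by apply: bnd kc; exact: ltW.
apply: (@ger_cvgy _ _ _ _ (fun n => loglog R n * (c / 2))); last first.
  by apply: cvgny_mul => //; rewrite divr_gt0.
near=> n.
have u1 : 1 <= loglog R n by near: n; exact: cvgry_ge.
have u0 : 0 < loglog R n by lra.
have : c / 2 <= (k n)%:R / loglog R n ^+ 3.
  by near: n; apply: (cvgr_ge _ kc); lra.
rewrite ler_pdivlMr ?exprn_gt0// => h.
rewrite ler_pdivlMr//; apply: le_trans h.
rewrite mulrAC mulrC ler_pM2l ?divr_gt0// exprS ler_pM2l//.
by rewrite expr2 ler_peMl// ltW.
Unshelve. all: by end_near. Qed.

Lemma stirling_err_cvg (R : realType) (i : nat -> nat) :
  i n @[n --> \oo] --> \oo -> (n - i n)%N @[n --> \oo] --> \oo ->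
  stirling_err R n (i n) @[n --> \oo] --> - (ln (2 * pi) / 2).
Proof.
move=> iy jy; have s := stirling R.
have -> : - (ln (2 * pi) / 2) = ln (2 * pi) / 2 - ln (2 * pi) / 2 - ln (2 * pi) / 2 :> R.
  by ring.
apply: cvgB; first apply: cvgB => //.
  exact: (cvg_comp i (stirling_rem R) iy s).
exact: (cvg_comp (fun n => n - i n)%N (stirling_rem R) jy s).
Qed.

(** The boolean [b] tells which end of the sample the rank is close to: [false]
    for case (a), where the skewness increases the tail, and [true] for case (b),
    where it decreases the tail, whence the sign [sg]. *)
Section hc_tail.
Context {R : realType} (t : R) (b : bool) (i : nat -> nat).
Hypothesis hi : forall n : nat, (0 < n)%N -> (1 <= i n <= n)%N.
Let m n := if b then (n - i n)%N else i n.
Hypothesis growth : loglog_growth R m.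

Let u n := loglog R n.
Let d n := hc_level t n.
Let h n := hc_crit n (i n) (d n).
Let x n : R := (i n)%:R - n%:R * h n.
Let a n : R := n%:R * h n.
Let c n : R := n%:R * (1 - h n).
Let p n : R := if b then c n else a n.
Let q n : R := if b then a n else c n.
Let T n : R := Num.sqrt 2 / 3 * (u n * Num.sqrt (u n / (m n)%:R)).
Let sg : R := (- 1) ^+ b.
Let S n := binom_tail R n (h n) (i n).
Let pref n : R := expR (- t) / (2 * u n * ln n%:R).

Let uy : u n @[n --> \oo] --> +oo. Proof. exact: loglog_cvgy. Qed.

Let m_over_n : (m n)%:R / n%:R @[n --> \oo] --> (0 : R).
Proof.
have [_ [C C0 mC]] := loglog_growthP _ _ growth.
have h0 : C * (u n ^+ 3 / n%:R) @[n --> \oo] --> (0 : R).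
  by rewrite -[X in _ --> X](mulr0 C); apply: cvgMl_tmp; exact: loglog3_over_cvg0.
apply: cvg0_le_near h0; near=> n.
rewrite ger0_norm ?divr_ge0// mulrA ler_wpM2r ?invr_ge0//.
by near: n.
Unshelve. all: by end_near. Qed.

Let m_cvgy : (m n)%:R @[n --> \oo] --> (+oo : set_system R).
Proof.
have [my _] := loglog_growthP _ _ growth.
apply: ger_cvgy my; near=> n.
have u1 : 1 <= u n by near: n; exact: cvgry_ge.
have u0 : 0 < u n by lra.
by rewrite ler_pdivrMr// ler_peMr.
Unshelve. all: by end_near. Qed.

Let near_m : \forall n \near \oo, (0 < n)%N /\ (m n)%:R <= n%:R / 2 :> R.
Proof.
near=> n.
have n0 : (0 < n)%N by near: n; exact: nbhs_infty_gt.
split => //; rewrite mulrC -ler_pdivrMr ?ltr0n//.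
by near: n; apply: (cvgr_le _ m_over_n).
Unshelve. all: by end_near. Qed.

Let near_i : \forall n \near \oo, (0 < i n < n)%N.
Proof.
near=> n.
have [n0 mn] : (0 < n)%N /\ (m n)%:R <= n%:R / 2 :> R by near: n.
have m0 : 0 < (m n)%:R :> R by near: n; exact: cvgry_gt.
have mn' : (m n < n)%N.
  by rewrite -(ltr_nat R) (le_lt_trans mn)// ltr_pdivrMr// ltr_pMr ?ltr1n// ltr0n.
have := hi n n0; rewrite ltr0n in m0; move: m0 mn'; rewrite /m.
by case: b => m0 mn' /andP[-> _] //=; rewrite -subn_gt0.
Unshelve. all: by end_near. Qed.

Let near_root : \forall n \near \oo, [/\ 0 < u n, 0 < d n & 0 < h n < 1] /\
  [/\ 0 < x n & x n ^+ 2 = d n ^+ 2 * (n%:R * h n * (1 - h n))].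
Proof.
near=> n.
have u0 : 0 < u n by near: n; exact: cvgry_gt.
have d0 : 0 < d n by near: n; exact: hc_level_gt0.
have i_n : (0 < i n < n)%N by near: n.
have [h01 hx xd] := hc_crit_root R n (i n) (d n) d0 i_n.
by split; split => //; rewrite /x subr_gt0.
Unshelve. all: by end_near. Qed.

Let near_pos : \forall n \near \oo,
  [/\ 0 < u n, 0 < (m n)%:R :> R, 0 < p n, 0 < q n & 0 < x n].
Proof.
near=> n.
have m0 : 0 < (m n)%:R :> R by near: n; exact: cvgry_gt.
have i_n : (0 < i n < n)%N by near: n.
have [[u0 d0 /andP[h0 h1]] [x0 xd]] : [/\ 0 < u n, 0 < d n & 0 < h n < 1] /\
  [/\ 0 < x n & x n ^+ 2 = d n ^+ 2 * (n%:R * h n * (1 - h n))] by near: n.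
have n0 : 0 < n%:R :> R by rewrite ltr0n; case/andP: i_n => ?; exact: leq_ltn_trans.
have a0 : 0 < a n by rewrite mulr_gt0.
have c0 : 0 < c n by rewrite mulr_gt0// subr_gt0.
by split => //; rewrite /p /q; case: b.
Unshelve. all: by end_near. Qed.

Let near_rel : \forall n \near \oo,
  [/\ p n + q n = n%:R, `|p n - (m n)%:R| = x n &
   x n ^+ 2 = d n ^+ 2 * (p n * q n / n%:R)].
Proof.
near=> n.
have /andP[i0 i_n] : (0 < i n < n)%N by near: n.
have [[u0 d0 /andP[h0 h1]] [x0 xd]] : [/\ 0 < u n, 0 < d n & 0 < h n < 1] /\
  [/\ 0 < x n & x n ^+ 2 = d n ^+ 2 * (n%:R * h n * (1 - h n))] by near: n.
have n0 : 0 < n%:R :> R by rewrite ltr0n; exact: leq_ltn_trans i_n.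
have ac : a n + c n = n%:R by rewrite /a /c; ring.
have acn : n%:R * h n * (1 - h n) = a n * c n / n%:R.
  by rewrite /a /c; field; rewrite gt_eqF.
rewrite xd acn /p /q /m; case: b; split => //.
- by rewrite addrC.
- rewrite natrB ?(ltnW i_n)// -[RHS](gtr0_norm x0); congr `|_|.
  by rewrite /c /x; ring.
- by rewrite [c n * _]mulrC.
- by rewrite distrC -[RHS](gtr0_norm x0).
Unshelve. all: by end_near. Qed.

Let cvg_d : d n ^+ 2 / (2 * u n) @[n --> \oo] --> (1 : R).
Proof. exact: hc_level_sqr_cvg. Qed.

Let cvg_m : (m n)%:R / u n @[n --> \oo] --> +oo.
Proof. by have [] := loglog_growthP _ _ growth. Qed.

Let cvg_w := @cvg_small_ratio R u (fun n => (m n)%:R) p q x d (fun n => n%:R)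
  near_pos near_rel cvg_d cvg_m.
Let cvg_v := @cvg_large_ratio R u (fun n => (m n)%:R) p q x d (fun n => n%:R)
  near_pos near_rel cvg_d cvg_m m_over_n.
Let skew_w := @cvg_skew_small R u (fun n => (m n)%:R) p q x d (fun n => n%:R)
  near_pos near_rel cvg_d cvg_m m_over_n.
Let skew_v := @cvg_skew_large R u (fun n => (m n)%:R) p q x d (fun n => n%:R)
  near_pos near_rel cvg_d cvg_m m_over_n.
Let skew_rem := @cvg_skew_rem R u (fun n => (m n)%:R) p q x d (fun n => n%:R)
  near_pos near_rel cvg_d cvg_m m_over_n.

Let cvg_y : x n / a n @[n --> \oo] --> (0 : R).
Proof. by have := cvg_w; have := cvg_v; rewrite /p /q; case: b. Qed.

Let cvg_z : x n / c n @[n --> \oo] --> (0 : R).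
Proof. by have := cvg_w; have := cvg_v; rewrite /p /q; case: b. Qed.

Let i_cvgy : i n @[n --> \oo] --> \oo /\ (n - i n)%N @[n --> \oo] --> \oo.
Proof.
have my : m n @[n --> \oo] --> \oo by apply/cvgrnyP; exact: m_cvgy.
have nmy : (n - m n)%N @[n --> \oo] --> \oo.
  apply/(cvgrnyP (R := R)).
  apply: (@ger_cvgy _ _ _ _ (fun n => n%:R * 2^-1)); last first.
    by apply: cvgny_mul => //; exact: cvgr_idn.
  near=> n.
  have [n0 mn] : (0 < n)%N /\ (m n)%:R <= n%:R / 2 :> R by near: n.
  rewrite natrB; first by lra.
  rewrite -(ler_nat R); have : 0 <= n%:R :> R by []. lra.
move: my nmy; rewrite /m; case: b => // my nmy; split => //.
apply: cvg_trans nmy; apply: near_eq_cvg; near=> n.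
have /andP[_ i_n] : (0 < i n < n)%N by near: n.
by rewrite subKn// ltnW.
Unshelve. all: by end_near. Qed.

(** The part of the expansion of [Q] that vanishes in the limit: the error of
    Stirling's formula, the calibration error of the level, and the ratios of [i]
    and [n - i] to their expected values. *)
Let o1 n : R := (stirling_err R n (i n) + ln (2 * pi) / 2) +
  ((- ln (d n) - d n ^+ 2 / 2 - ln (2 * pi) / 2) - ln (pref n)) +
  (ln (1 + x n / a n) - ln (1 - x n / c n)) / 2.

Let cvg_o1 : o1 n @[n --> \oo] --> (0 : R).
Proof.
have [iy jy] := i_cvgy.
have -> : (0 : R) = (- (ln (2 * pi) / 2) + ln (2 * pi) / 2) + 0 + (0 - 0) * 2^-1.
  by rewrite addNr subrr mul0r !addr0.
apply: cvgD; first apply: cvgD.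
- by apply: cvgD; [exact: stirling_err_cvg|exact: cvg_cst].
- exact: hc_level_gaussian_tail.
apply: cvgMr_tmp; rewrite -(@ln1 R); apply: cvgB; apply: cvg_ln => //.
  by rewrite -[X in _ --> X]addr0; apply: cvgD => //; exact: cvg_cst.
by rewrite -[X in _ --> X]subr0; apply: cvgB => //; exact: cvg_cst.
Qed.

(** The bound [m <= C * u ^+ 3] gives [T ^+ 2 >= 2 / (9 * C)], so that [o(1)] is
    [o(T)]. *)
Let T_lower : exists2 B : R, 0 < B & \forall n \near \oo, 0 < T n /\ (T n)^-1 <= B.
Proof.
have [_ [C C0 mC]] := loglog_growthP _ _ growth.
exists (Num.sqrt (2 / (9 * C)))^-1.
  by rewrite invr_gt0 sqrtr_gt0 divr_gt0// mulr_gt0.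
near=> n.
have [u0 m0 p0 q0 x0] : [/\ 0 < u n, 0 < (m n)%:R :> R, 0 < p n, 0 < q n & 0 < x n].
  by near: n.
have mCn : (m n)%:R <= C * u n ^+ 3 by near: n.
have um0 : 0 < u n / (m n)%:R by rewrite divr_gt0.
have su0 : 0 < Num.sqrt (u n / (m n)%:R) by rewrite sqrtr_gt0.
have T0 : 0 < T n by rewrite /T !mulr_gt0 ?invr_gt0 ?sqrtr_gt0.
split => //; rewrite lef_pV2 ?posrE ?sqrtr_gt0 ?divr_gt0 ?mulr_gt0//.
rewrite -[leRHS]ger0_norm ?(ltW T0)// -sqrtr_sqr ler_wsqrtr//.
have -> : T n ^+ 2 = 2 / 9 * u n ^+ 3 / (m n)%:R.
  rewrite /T !exprMn !sqr_sqrtr ?(ltW um0)//; field; rewrite gt_eqF//.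
rewrite ler_pdivlMr// -ler_pdivlMl ?divr_gt0 ?mulr_gt0//.
have -> : (2 / (9 * C))^-1 * (2 / 9 * u n ^+ 3) = C * u n ^+ 3.
  by field; rewrite gt_eqF.
by [].
Unshelve. all: by end_near. Qed.

Let Q n : R := ln (S n) - ln (pref n).

Let Q_expansion : \forall n \near \oo, 0 < S n /\
  `|Q n - (o1 n + sg * (x n * (x n / p n) ^+ 2 / 6 - x n * (x n / q n) ^+ 2 / 6))|
   <= 2 * (x n * ((x n / p n) ^+ 3 + (x n / q n) ^+ 3)) + d n ^- 2.
Proof.
near=> n.
have i_n : (0 < i n < n)%N by near: n.
have [[u0 d0 h01] [x0 xd]] : [/\ 0 < u n, 0 < d n & 0 < h n < 1] /\
  [/\ 0 < x n & x n ^+ 2 = d n ^+ 2 * (n%:R * h n * (1 - h n))] by near: n.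
have y12 : x n / a n <= 2^-1 by near: n; apply: (cvgr_le _ cvg_y).
have z12 : x n / c n <= 2^-1 by near: n; apply: (cvgr_le _ cvg_z).
have [S0 _] := ln_binom_tail_mass R n (i n) (h n) (d n) i_n h01 d0 x0 xd.
split => //.
have := ln_binom_tail R n (i n) (h n) (d n) i_n h01 d0 x0 xd y12 z12.
rewrite -/(x n) -/(a n) -/(c n) -/(S n).
rewrite (_ : 2 * x n * _ =
  2 * (x n * ((x n / p n) ^+ 3 + (x n / q n) ^+ 3))); last first.
  by rewrite /p /q; case: b; ring.
congr (`|_| <= _).
by rewrite /Q /o1 /sg /p /q; case: b; rewrite ?expr1 ?expr0; lra.
Unshelve. all: by end_near. Qed.

Let cvg_d2 : d n ^- 2 @[n --> \oo] --> (0 : R).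
Proof.
have v0 : (2 * u n)^-1 @[n --> \oo] --> (0 : R).
  apply: cvg_invy0; apply: cvg_trans (cvgny_mul _ _ 2 _ uy) => //.
  by apply: near_eq_cvg; apply: nearW => n; rewrite mulrC.
have := cvgn_mul _ _ _ _ _ (cvgn_inv _ _ _ (oner_neq0 R) cvg_d) v0.
rewrite mulr0; apply: cvg_eq_near; near=> n.
have u0 : 0 < u n by near: n; exact: cvgry_gt.
have d0 : 0 < d n by near: n; exact: hc_level_gt0.
by field; rewrite !gt_eqF.
Unshelve. all: by end_near. Qed.

Let cvg_ratio : Q n / (sg * T n) - 1 @[n --> \oo] --> (0 : R).
Proof.
have [B B0 TB] := T_lower.
pose bound n := 2 * (x n * ((x n / p n) ^+ 3 + (x n / q n) ^+ 3) / T n)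
  + d n ^- 2 * B + `|o1 n| * B
  + `|x n * (x n / p n) ^+ 2 / 6 / T n - 1| + `|x n * (x n / q n) ^+ 2 / 6 / T n|.
apply: (@cvg0_le_near _ _ bound); last first.
  have -> : (0 : R) = 2 * 0 + 0 * B + 0 * B + 0 + 0 by rewrite !(mulr0, mul0r, addr0).
  apply: cvgD; [apply: cvgD; [apply: cvgD; [apply: cvgD|]|]|].
  - exact: cvgMl_tmp.
  - exact: cvgMr_tmp cvg_d2.
  - by apply: cvgMr_tmp; apply/norm_cvg0P.
  - apply/norm_cvg0P; rewrite -[X in _ --> X](subrr 1); apply: cvgB => //.
    exact: cvg_cst.
  - exact/norm_cvg0P.
near=> n.
have [T0 Ti] : 0 < T n /\ (T n)^-1 <= B by near: n.
have [S0 QE] : 0 < S n /\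
  `|Q n - (o1 n + sg * (x n * (x n / p n) ^+ 2 / 6 - x n * (x n / q n) ^+ 2 / 6))|
   <= 2 * (x n * ((x n / p n) ^+ 3 + (x n / q n) ^+ 3)) + d n ^- 2 by near: n.
have sg1 : `|sg| = 1 by rewrite /sg normrX normrN1 expr1n.
have sg2 : sg * sg = 1 by rewrite /sg -expr2 sqrr_sign.
have sgV : sg^-1 = sg by rewrite /sg invr_sign.
move: QE; set W := x n * _ / 6; set V := x n * _ / 6; set X := x n * _.
set rho := Q n - _ => QE.
have -> : Q n / (sg * T n) - 1 =
    sg * rho / T n + sg * o1 n / T n + (W / T n - 1) - V / T n.
  have -> : Q n = rho + (o1 n + sg * (W - V)) by rewrite /rho subrK.
  rewrite invfM sgV.
  transitivity (sg * rho / T n + sg * o1 n / T n + (sg * sg) * (W / T n - V / T n) - 1).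
    by ring.
  by rewrite sg2; ring.
have d20 : 0 <= d n ^- 2 by rewrite invr_ge0 sqr_ge0.
have rhoT : `|sg * rho / T n| <= 2 * (X / T n) + d n ^- 2 * B.
  rewrite !normrM sg1 mul1r (gtr0_norm (_ : 0 < (T n)^-1)) ?invr_gt0//.
  apply: (@le_trans _ _ ((2 * X + d n ^- 2) / T n)).
    by rewrite ler_pM2r ?invr_gt0.
  by rewrite mulrDl mulrA lerD2l ler_wpM2l.
have o1T : `|sg * o1 n / T n| <= `|o1 n| * B.
  rewrite !normrM sg1 mul1r (gtr0_norm (_ : 0 < (T n)^-1)) ?invr_gt0//.
  by rewrite ler_wpM2l.
rewrite /bound -/X.
apply: le_trans (ler_normB _ _) _; rewrite lerD2r.
apply: le_trans (ler_normD _ _) _; rewrite lerD2r.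
by apply: le_trans (ler_normD _ _) _; rewrite lerD.
Unshelve. all: by end_near. Qed.

(** The error [e] is defined by solving the equation for it; it is [o(u)] because
    the log-ratio [Q] of the tail to its Gaussian prefactor is equivalent to
    [sg * T]. *)
Lemma binom_tail_asymptotics : exists e : nat -> R,
  e =o_\oo (fun n : nat => loglog R n) /\
  \forall n \near \oo,
    [/\ 0 <= h n <= 1, (0 < i n <= n)%N &
    S n = expR (- t) / (2 * loglog R n * ln n%:R) *
      expR (Num.sqrt 2 * (sg * Num.sqrt (loglog R n / (m n)%:R)) / 3 *
         (loglog R n + e n))].
Proof.
exists (fun n => u n * (Q n / (sg * T n) - 1)); split.
  apply/eqoP => eps eps0; near=> n.
  rewrite normrM mulrC ler_wpM2r//.
  by near: n; move/cvgr0Pnorm_le : cvg_ratio; exact.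
have [B B0 TB] := T_lower.
near=> n.
have [T0 Ti] : 0 < T n /\ (T n)^-1 <= B by near: n.
have /andP[i0 i_n] : (0 < i n < n)%N by near: n.
have [S0 QE] : 0 < S n /\
  `|Q n - (o1 n + sg * (x n * (x n / p n) ^+ 2 / 6 - x n * (x n / q n) ^+ 2 / 6))|
   <= 2 * (x n * ((x n / p n) ^+ 3 + (x n / q n) ^+ 3)) + d n ^- 2 by near: n.
have [[u0 d0 /andP[h0 h1]] [x0 xd]] : [/\ 0 < u n, 0 < d n & 0 < h n < 1] /\
  [/\ 0 < x n & x n ^+ 2 = d n ^+ 2 * (n%:R * h n * (1 - h n))] by near: n.
have [uE _] : expR (u n) = ln n%:R /\ expR (ln n%:R) = n%:R :> R.
  by near: n; exact: loglog_expR.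
split; [by rewrite !ltW|by rewrite i0 ltnW|].
have pref0 : 0 < pref n by rewrite /pref divr_gt0 ?mulr_gt0 ?expR_gt0 -?uE ?expR_gt0.
have sg0 : sg != 0 by rewrite /sg signr_eq0.
rewrite -/(u n) -/(pref n).
rewrite (_ : Num.sqrt 2 * _ / 3 * _ = Q n); last first.
  have -> : Num.sqrt 2 * (sg * Num.sqrt (u n / (m n)%:R)) / 3 = sg * T n / u n.
    by rewrite /T; field; rewrite gt_eqF.
  by field; rewrite sg0 !gt_eqF.
by rewrite /Q expRB !lnK ?posrE// mulrC divfK// gt_eqF.
Unshelve. all: by end_near. Qed.

End hc_tail.

Theorem lemma4p4 (R : realType) (t : R)
    (disp : nat -> measure_display)
    (T : forall n : nat, measurableType (disp n))
    (P : forall n : nat, probability (T n) R)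
    (U : forall n : nat, 'I_n -> {RV (P n) >-> R})
    (hU : forall n : nat, iid_uniform01 (U n))
    (i : nat -> nat)
    (hi : forall n : nat, (0 < n)%N -> (1 <= i n <= n)%N)
    (zeta : nat -> R)
    (hzeta :
      (loglog_growth R i /\
       (forall n : nat, zeta n = Num.sqrt (loglog R n / (i n)%:R))) \/
      (loglog_growth R (fun n => n - i n)%N /\
       (forall n : nat, zeta n = - Num.sqrt (loglog R n / (n - i n)%:R)))) :
  exists e : nat -> R,
    e =o_\oo (fun n : nat => loglog R n) /\
    \forall n \near \oo,
      local_level (U n) t (i n) =
      (expR (- t) / (2 * loglog R n * ln n%:R)
       * expR (Num.sqrt 2 * zeta n / 3 * (loglog R n + e n)))%:E.
Proof.
have core b : loglog_growth R (fun n => if b then (n - i n)%N else i n) ->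
    (forall n, zeta n = (-1) ^+ b *
      Num.sqrt (loglog R n / (if b then (n - i n)%N else i n)%:R)) ->
    exists e : nat -> R,
    e =o_\oo (fun n : nat => loglog R n) /\
    \forall n \near \oo,
      local_level (U n) t (i n) =
      (expR (- t) / (2 * loglog R n * ln n%:R)
       * expR (Num.sqrt 2 * zeta n / 3 * (loglog R n + e n)))%:E.
  move=> growth zetaE.
  have [e [eo eE]] := binom_tail_asymptotics t b i hi growth.
  exists e; split => //; apply: filterS eE => n [h01 i_n SE].
  by rewrite /local_level (prob_order_stat_lt _ h01 (hU n) _ i_n) SE zetaE.
by case: hzeta => -[growth zetaE]; [apply: (core false)|apply: (core true)] => // n;
  rewrite zetaE ?expr0 ?expr1 ?mul1r ?mulN1r.
Qed.
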